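(* Let $d\ge1$, $T>0$, and let $h\in C^\infty([0,T]\times\mathbf{T}^d)$ be a smooth positive solution to $$\partial_t h-\operatorname{div}(h\nabla h)=0 .$$ Then, for all $t\in[0,T]$, $$\frac{d}{dt}\int_{\mathbf{T}^d}h^2\,dx\le0\quad\text{and}\quad\frac{d^2}{dt^2}\int_{\mathbf{T}^d}h^2\,dx\ge0,$$ together with $$\frac{d}{dt}\int_{\mathbf{T}^d}h\log h\,dx\le0\quad\text{and}\quad\frac{d^2}{dt^2}\int_{\mathbf{T}^d}h\log h\,dx\ge0 .$$
   Context: $\mathbf{T}^d$ is a $d$-dimensional (flat) torus; $\nabla$ and $\operatorname{div}$ are taken with respect to $x\in\mathbf{T}^d$. *)

(* Defs.v *)
From HB Require Import structures.
From mathcomp Require Export all_boot all_order all_algebra.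
From mathcomp Require Export all_classical all_reals all_analysis.

Set Implicit Arguments.
Unset Strict Implicit.
Unset Printing Implicit Defensive.

Import Order.TTheory GRing.Theory Num.Theory.
Export numFieldNormedType.Exports.

Local Open Scope classical_set_scope.
Local Open Scope ring_scope.

Section time_derivative.
Context {R : realType}.
Implicit Types (A : set R) (f : R -> R) (t : R).

(* Differentiation relative to A: with A = [0, T] it is two-sided at interior
   points and one-sided at 0 and T; values of f outside A are irrelevant. *)
Definition diff_quot f t (s : R) : R := (s - t)^-1 * (f s - f t).

Definition derivable_in A f t : Prop := cvg (diff_quot f t @ within A t^').

Definition derive_in A f t : R := lim (diff_quot f t @ within A t^').

End time_derivative.

Section space_time.
Context {R : realType} {d : nat}.
Implicit Types (T t : R) (f : 'rV[R]_d -> R) (u : R -> 'rV[R]_d -> R).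

Definition basis_vec (i : 'I_d) : 'rV[R]_d := delta_mx 0 i.

Definition grad f (x : 'rV[R]_d) : 'rV[R]_d := \row_i 'D_(basis_vec i) f x.

Definition div (V : 'rV[R]_d -> 'rV[R]_d) (x : 'rV[R]_d) : R :=
  \sum_(i < d) 'D_(basis_vec i) (fun y => V y 0 i) x.

Definition dt T u : R -> 'rV[R]_d -> R :=
  fun t x => derive_in `[0, T] (u ^~ x) t.

Definition dx (i : 'I_d) u : R -> 'rV[R]_d -> R :=
  fun t x => 'D_(basis_vec i) (u t) x.

(* u is C^n on [0, T] x R^d: every iterated partial derivative of order at most
   n, in any order of differentiation, exists and is jointly continuous up to
   the boundary times t = 0 and t = T. *)
Fixpoint Cn_on T (n : nat) u : Prop :=
  {within `[0, T] `*` [set: 'rV[R]_d],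
    continuous (fun p : R * 'rV[R]_d => u p.1 p.2)} /\
  if n is m.+1 then
    [/\ forall (t : R) x, t \in `[0, T] -> derivable_in `[0, T] (u ^~ x) t,
        forall (t : R) x i, t \in `[0, T] -> derivable (u t) x (basis_vec i),
        Cn_on T m (dt T u)
      & forall i, Cn_on T m (dx i u)]
  else True.

Definition smooth_on T u : Prop := forall n, Cn_on T n u.

End space_time.

Section flat_torus.
Context {R : realType}.

(* A flat torus is R^d / L, where L is the lattice of integer combinations of
   the rows of an invertible matrix B (B = 1%:M gives R^d / Z^d); functions on
   it are L-periodic functions on R^d. *)
Definition lattice d (B : 'M[R]_d) : set 'rV[R]_d :=
  [set map_mx intr z *m B | z in [set: 'rV[int]_d]].

Definition periodic d (B : 'M[R]_d) (f : 'rV[R]_d -> R) : Prop :=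
  forall x v, lattice B v -> f (x + v) = f x.

(* Iterated Lebesgue integral over the unit cube [0, 1]^d, one coordinate at a
   time; this is the d-dimensional integral for continuous integrands. *)
Fixpoint cube_int (d : nat) : ('rV[R]_d -> R) -> R :=
  match d with
  | 0 => fun f => f 0
  | d'.+1 => fun f =>
      \int[lebesgue_measure]_(s in `[0, 1])
        cube_int (fun y : 'rV[R]_d' => f (row_mx (s%:M : 'rV[R]_1) y))
  end.

(* Integral over the fundamental cell [0, 1]^d *m B of the lattice. *)
Definition torus_int d (B : 'M[R]_d) (f : 'rV[R]_d -> R) : R :=
  `|\det B| * cube_int (fun y => f (y *m B)).

End flat_torus.

(* Main.v *)
Require Import Defs.
From mathcomp Require Import ring.
Set Implicit Arguments.
Unset Strict Implicit.
Unset Printing Implicit Defensive.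
Import Order.TTheory GRing.Theory Num.Theory.
Local Open Scope classical_set_scope.
Local Open Scope ring_scope.

(* Write u = h(t, .), u_i and u_ij for its partial derivatives and
   w = div (u grad u) = dt h. On a torus the integral of a partial derivative
   vanishes, so
     (int h^2)'    = 2 int u w = - 2 int u |grad u|^2,
     (int h ln h)' = int (ln u + 1) w = - int |grad u|^2.
   For the second derivatives, the weak form int phi dt h = 1/2 int h^2 Lap phi,
   with phi independent of time, is differentiated once more in time and then
   used with phi = u, respectively phi = ln u + 1:
     (int h^2)''    = int 2 w^2 + 2 u w Lap u,
     (int h ln h)'' = 2 int w Lap u.
   Up to a divergence these integrands are
     2 u^2 ((Lap u)^2 + sum_ij u_ij^2)  and
     2/3 u ((Lap u)^2 + 2 sum_ij u_ij^2). *)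

(** * Integration over the cube *)

(** Only partial derivatives along basis vectors are given, one-sided in time at 0 and T, and the
    integral is iterated one coordinate at a time. Total derivatives, Fubini and dominated
    convergence are avoided: the mean value theorem, with joint continuity on the compact cube,
    makes every needed limit uniform. The sums of squares come from two divergences. Put q = sum_ij
    u_i u_j u_ij and sum over i, j. The field u^k (u_jj u_i - u_ij u_j) has divergence u^k ((Lap
    u)^2 - sum_ij u_ij^2) + k u^(k-1) (|grad u|^2 Lap u - q). The field u^(k-1) u_j^2 u_i has
    divergence u^(k-1) (|grad u|^2 Lap u + 2 q) + (k-1) u^(k-2) |grad u|^4. With weights a and b,
    the terms in q cancel when 2 b = k a. Matching |grad u|^2 Lap u requires 2 a + b = 6 for h^2,
    where k = 2, and a + b = 2 for h ln h, where k = 1. Hence a = b = 2, respectively a = 4/3 and b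
    = 2/3. *)

Section continuous_real_functions.
Context {R : realType} {V : topologicalType}.
Implicit Types f g : V -> R.

Lemma continuous_cst (c : R) : continuous (fun _ : V => c).
Proof. by move=> x; exact: cvg_cst. Qed.

Lemma continuous_add f g : continuous f -> continuous g ->
  continuous (fun x => f x + g x).
Proof. by move=> cf cg x; apply: cvgD; [exact: cf|exact: cg]. Qed.

Lemma continuous_mul f g : continuous f -> continuous g ->
  continuous (fun x => f x * g x).
Proof. by move=> cf cg x; apply: cvgM; [exact: cf|exact: cg]. Qed.

Lemma continuous_sumr (I : finType) (f : I -> V -> R) :
  (forall i, continuous (f i)) -> continuous (fun x => \sum_i f i x).
Proof.
move=> cf; elim: (index_enum I) => [|i s IH].
  by under eq_fun do rewrite big_nil; exact: continuous_cst.
by under eq_fun do rewrite big_cons; exact: continuous_add.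
Qed.

Lemma continuous_inv f : continuous f -> (forall x, f x != 0) ->
  continuous (fun x => (f x)^-1).
Proof. by move=> cf f0 x; apply: cvgV; [exact: f0|exact: cf]. Qed.

Lemma continuous_ln_comp f : continuous f -> (forall x, 0 < f x) ->
  continuous (fun x => ln (f x)).
Proof.
move=> cf f0 x; apply: (@cvg_comp _ _ _ f (@ln R) _ (nbhs (f x))); first exact: cf.
by apply: continuous_ln; exact: f0.
Qed.

End continuous_real_functions.

Section cube_integral.
Context {R : realType}.
Implicit Types d : nat.

Lemma cvg_rV d (T : Type) (F : set_system T) {FF : Filter F}
    (f : T -> 'rV[R]_d) (l : 'rV[R]_d) :
  (forall j, f x 0 j @[x --> F] --> l 0 j) -> f @ F --> l.
Proof.
move=> fl; apply/cvg_ballP => e e0.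
have : \forall x \near F, forall j, ball (l 0 j) e (f x 0 j).
  by apply: filter_forall => j; exact: (cvg_ball (fl j)).
by apply: filterS => x H; split => // i j; rewrite (ord1 i).
Qed.

Lemma cvg_coord d (T : Type) (F : set_system T) {FF : Filter F}
    (f : T -> 'rV[R]_d) (l : 'rV[R]_d) j :
  f @ F --> l -> f x 0 j @[x --> F] --> l 0 j.
Proof. move=> fl; apply: (@cvg_comp _ _ _ f (fun M => M 0 j) F (nbhs l)) => //.
exact: coord_continuous. Qed.

Lemma cvg_row_mx d (T : Type) (F : set_system T) {FF : Filter F}
    (s : T -> R) (y : T -> 'rV[R]_d) (s0 : R) (y0 : 'rV[R]_d) :
  s @ F --> s0 -> y @ F --> y0 ->
  row_mx ((s x)%:M : 'rV[R]_1) (y x) @[x --> F] --> row_mx (s0%:M : 'rV[R]_1) y0.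
Proof.
move=> ss yy; apply: (@cvg_rV (1 + d)) => j.
case: (split_ordP j) => k ->.
  under eq_fun do rewrite row_mxEl (ord1 k) mxE eqxx.
  by rewrite row_mxEl (ord1 k) mxE eqxx.
under eq_fun do rewrite row_mxEr.
by rewrite row_mxEr; exact: cvg_coord.
Qed.

Lemma cvg_comp_row_mx d (T : Type) (F : set_system T) {FF : Filter F}
    (f : 'rV[R]_d.+1 -> R) (s : T -> R) (y : T -> 'rV[R]_d) (s0 : R)
    (y0 : 'rV[R]_d) : continuous f -> s @ F --> s0 -> y @ F --> y0 ->
  f (row_mx ((s x)%:M : 'rV[R]_1) (y x)) @[x --> F] -->
  f (row_mx (s0%:M : 'rV[R]_1) y0).
Proof.
move=> cf ss yy; have rr := cvg_row_mx ss yy.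
by move=> A /cf; exact: rr.
Qed.

Definition unit_cube d : set 'rV[R]_d := [set y | forall i, `[0, 1]%classic (y 0 i)].

Lemma unit_cube_compact d : compact (@unit_cube d).
Proof.
exact: (@rV_compact R d (fun=> `[0, 1]%classic) (fun=> @segment_compact _ _ _)).
Qed.

Lemma unit_cube_row_mx d (s : R) (y : 'rV[R]_d) :
  `[0, 1]%classic s -> unit_cube y -> unit_cube (row_mx (s%:M : 'rV[R]_1) y).
Proof.
move=> s01 y01 j; case: (@split_ordP 1 d j) => k ->.
  by rewrite row_mxEl (ord1 k) mxE eqxx.
by rewrite row_mxEr.
Qed.

(* The properties of cube_int that the induction on the dimension needs. *)
Definition mean_on_continuous d (J : ('rV[R]_d -> R) -> R) :=
  [/\ forall f g : 'rV[R]_d -> R, continuous f -> continuous g ->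
        J (fun y => f y + g y) = J f + J g,
      forall (c : R) (f : 'rV[R]_d -> R), continuous f -> J (fun y => c * f y) = c * J f,
      forall f g : 'rV[R]_d -> R, continuous f -> continuous g ->
        (forall y, unit_cube y -> f y <= g y) -> J f <= J g
    & forall c, J (fun=> c) = c].

(** A uniform bound by e on the cube traps f between g - e and g + e, and [J] shifts by exactly e
    because it fixes constants. *)
Lemma mean_cvg d (J : ('rV[R]_d -> R) -> R) (T : Type) (F : set_system T)
    {FF : Filter F} (f : T -> 'rV[R]_d -> R) (g : 'rV[R]_d -> R) :
  mean_on_continuous J -> (\forall i \near F, continuous (f i)) ->
  continuous g ->
  (forall e : R, 0 < e -> \forall i \near F,
     forall y, unit_cube y -> `|f i y - g y| <= e) ->
  J (f i) @[i --> F] --> J g.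
Proof.
move=> [JD JZ Jle Jc] cf cg fg; apply/cvgrPdist_le => e e0.
near=> i.
have cfi : continuous (f i) by near: i.
have fgi : forall y, unit_cube y -> `|f i y - g y| <= e by near: i; exact: fg.
have ce (h : 'rV[R]_d -> R) : continuous h -> continuous (fun y => h y + e).
  by move=> ch; apply: continuous_add => //; exact: continuous_cst.
have Je (h : 'rV[R]_d -> R) : continuous h -> J (fun y => h y + e) = J h + e.
  by move=> ch; rewrite JD ?Jc//; exact: continuous_cst.
rewrite ler_distl; apply/andP; split.
  rewrite lerBlDr -Je//; apply: Jle => //; first exact: ce.
  by move=> y /fgi; rewrite ler_distl => /andP[_].
rewrite -Je//; apply: Jle => //; first exact: ce.
by move=> y /fgi; rewrite ler_distl lerBlDr => /andP[].
Unshelve. all: by end_near. Qed.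

(** Compactness of the cube turns joint convergence at each of its points into uniform convergence,
    as in the tube lemma. *)
Lemma near_unit_cube d (T : Type) (F : set_system T) {FF : Filter F}
    (f : T -> 'rV[R]_d -> R) (g : 'rV[R]_d -> R) :
  continuous g ->
  (forall y, unit_cube y -> f p.2 p.1 @[p --> filter_prod (nbhs y) F] --> g y) ->
  forall e : R, 0 < e -> \forall i \near F,
     forall y, unit_cube y -> `|f i y - g y| <= e.
Proof.
move=> cg fg e e0.
have /compact_near_coveringP cK := @unit_cube_compact d.
apply: (cK _ _ (fun i y => `|f i y - g y| <= e)) => y Ky.
have : f p.2 p.1 - g p.1 @[p --> filter_prod (nbhs y) F] --> (0 : R).
  rewrite -(subrr (g y)); apply: cvgB; first exact: fg.
  by apply: cvg_comp; [exact: cvg_fst|exact: cg].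
move/cvgrPdist_le => /(_ e e0).
by apply: filterS => -[y' i] /=; rewrite sub0r normrN.
Qed.

Lemma continuous_Rintegrable01 (f : R -> R) : continuous f ->
  (@lebesgue_measure R).-integrable `[0, 1]%classic (EFin \o f).
Proof.
move=> cf; apply: continuous_compact_integrable; first exact: segment_compact.
exact: continuous_subspaceT.
Qed.

Lemma slice_continuous d (f : 'rV[R]_d.+1 -> R) (s : R) : continuous f ->
  continuous (fun y : 'rV[R]_d => f (row_mx (s%:M : 'rV[R]_1) y)).
Proof.
move=> cf y.
exact: (@cvg_comp_row_mx d _ (nbhs y) _ f (fun=> s) id s y cf (cvg_cst _) cvg_id).
Qed.

Lemma mean_slice_continuous d (J : ('rV[R]_d -> R) -> R) (f : 'rV[R]_d.+1 -> R) :
  mean_on_continuous J -> continuous f ->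
  continuous (fun s : R => J (fun y => f (row_mx (s%:M : 'rV[R]_1) y))).
Proof.
move=> HJ cf s; apply: mean_cvg => //.
- by apply: nearW => s'; exact: slice_continuous.
- exact: slice_continuous.
- apply: near_unit_cube; first exact: slice_continuous.
  by move=> y _; apply: cvg_comp_row_mx; [|exact: cvg_snd|exact: cvg_fst].
Qed.

(** The induction carries its own integrability: the properties in dimension d make the inner mean
    continuous in the outer variable, hence integrable on [0, 1]. *)
Lemma cube_int_mean d : mean_on_continuous (@cube_int R d).
Proof.
elim: d => [|d IH].
  by split=> //= f g cf cg; apply => -[].
have [JD JZ Jle Jc] := IH.
have m01 : measurable (`[0, 1]%classic : set R) by exact: measurable_itv.
have ints (f : 'rV[R]_d.+1 -> R) : continuous f ->
    (@lebesgue_measure R).-integrable `[0, 1]%classic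
      (EFin \o (fun s => cube_int (fun y : 'rV[R]_d => f (row_mx (s%:M : 'rV[R]_1) y)))).
  by move=> cf; apply: continuous_Rintegrable01; exact: mean_slice_continuous.
split=> /= [f g cf cg|c f cf|f g cf cg fg|c].
- rewrite -RintegralD//; [|exact: ints..].
  by apply: eq_Rintegral => s _; rewrite JD//; exact: slice_continuous.
- rewrite -RintegralZl//; [|exact: ints].
  by apply: eq_Rintegral => s _; rewrite JZ//; exact: slice_continuous.
- apply: le_Rintegral => //; [exact: ints..|].
  move=> s s01; apply: Jle; [exact: slice_continuous..|].
  by move=> y Ky; apply: fg; exact: unit_cube_row_mx.
- rewrite -[RHS]mulr1.
  under eq_Rintegral do rewrite Jc.
  rewrite Rintegral_cst//; congr (_ * _).
  have m1 : @lebesgue_measure R `[0, 1]%classic = 1%E.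
    by rewrite lebesgue_measure_itv/= lte01 oppr0 adde0.
  by rewrite -[RHS]/(fine 1%E) -m1.
Qed.

End cube_integral.

(** * Derivatives relative to an interval *)

Section relative_derivative.
Context {R : realType}.
Implicit Types (A : set R) (f g : R -> R).

(** The relational form carries the value of the limit, so the calculus rules need neither existence
    conditions nor uniqueness of limits. *)
Definition is_derive_in A f (t l : R) : Prop :=
  diff_quot f t @ within A t^' --> l.

Lemma derivable_inP A f t : derivable_in A f t ->
  is_derive_in A f t (derive_in A f t).
Proof. by []. Qed.

(** Every point of a nondegenerate segment is an accumulation point of it: from the right if t < b,
    from the left if t = b. This gives uniqueness of relative derivatives. *)
Lemma within_itv_dnbhs_proper (a b t : R) : a < b -> t \in `[a, b] ->
  ProperFilter (within `[a, b]%classic t^').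
Proof.
move=> ab; rewrite in_itv/= => /andP[at_ tb].
apply: Build_ProperFilter_ex => P /=.
rewrite /within/= => -[e /= e0 eP].
have [tb'|bt] := ltP t b.
- exists (t + Num.min (e / 2) (b - t)).
  have m0 : 0 < Num.min (e / 2) (b - t) by rewrite lt_min divr_gt0//= subr_gt0.
  apply: eP => /=.
  + rewrite opprD addNKr normrN gtr0_norm// gt_min; apply/orP; left.
    by rewrite ltr_pdivrMr// ltr_pMr// ltr1n.
  + by rewrite gt_eqF// ltrDl.
  + rewrite in_itv/= (le_trans at_) ?lerDl ?(ltW m0)//=.
    by rewrite -lerBrDl ge_min lexx orbT.
- have tbE : t = b by apply/eqP; rewrite eq_le tb bt.
  exists (t - Num.min (e / 2) (t - a)).
  have m0 : 0 < Num.min (e / 2) (t - a).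
    by rewrite lt_min divr_gt0//= subr_gt0 tbE.
  apply: eP => /=.
  + rewrite opprB addrC subrK gtr0_norm// gt_min; apply/orP; left.
    by rewrite ltr_pdivrMr// ltr_pMr// ltr1n.
  + by rewrite lt_eqF// ltrBlDr ltrDl.
  + rewrite in_itv/= (le_trans _ tb) ?lerBlDr ?lerDl ?(ltW m0)// andbT.
    by rewrite lerBrDl -lerBrDr ge_min lexx orbT.
Qed.

Lemma is_derive_in_val (a b t : R) f l : a < b -> t \in `[a, b] ->
  is_derive_in `[a, b] f t l ->
  derivable_in `[a, b] f t /\ derive_in `[a, b] f t = l.
Proof.
move=> ab tab fl; have PF := within_itv_dnbhs_proper ab tab.
by split; [apply/cvg_ex; exists l|exact: cvg_lim fl].
Qed.

Lemma is_derive_in_unique (a b t : R) f l1 l2 : a < b -> t \in `[a, b] ->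
  is_derive_in `[a, b] f t l1 -> is_derive_in `[a, b] f t l2 -> l1 = l2.
Proof.
move=> ab tab /(is_derive_in_val ab tab)[_ <-] /(is_derive_in_val ab tab)[_ <-].
by [].
Qed.

Lemma is_derive_in_ext A f g t l : A t -> (forall s, A s -> f s = g s) ->
  is_derive_in A f t l -> is_derive_in A g t l.
Proof.
move=> At fg; apply: cvg_trans; apply: near_eq_cvg.
rewrite near_withinE; near=> s => As.
by rewrite /diff_quot fg// (fg t).
Unshelve. all: by end_near. Qed.

Lemma dnbhs_within_neq A (t : R) : \forall s \near within A t^', s != t.
Proof.
by rewrite near_withinE; near=> s => _; near: s; exists 1 => /=.
Unshelve. all: by end_near. Qed.

Lemma is_derive_in_cvg A f t l : is_derive_in A f t l ->
  f @ within A t^' --> f t.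
Proof.
move=> fl.
have : diff_quot f t s * (s - t) + f t @[s --> within A t^'] --> l * (t - t) + f t.
  apply: cvgD; last exact: cvg_cst.
  apply: cvgM => //; apply: cvgB; last exact: cvg_cst.
  by apply: cvg_within_filter; apply: cvg_within.
rewrite subrr mulr0 add0r; apply: cvg_trans; apply: near_eq_cvg.
apply: filterS (dnbhs_within_neq A t) => s st.
by rewrite /diff_quot mulrAC mulVf ?subr_eq0// mul1r subrK.
Qed.

Lemma is_derive_in_cvg_within A f t l : is_derive_in A f t l ->
  f @ within A (nbhs t) --> f t.
Proof.
move=> /is_derive_in_cvg fl; apply/cvgrPdist_le => e e0.
have /cvgrPdist_le/(_ e e0) := fl.
rewrite !near_withinE => -[d /= d0 dP]; exists d => //= s sd As.
have [->|st] := eqVneq s t; first by rewrite subrr normr0 ltW.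
exact: dP.
Qed.

Lemma is_derive_in_add A f g t l m : is_derive_in A f t l ->
  is_derive_in A g t m -> is_derive_in A (fun s => f s + g s) t (l + m).
Proof.
move=> fl gm; rewrite /is_derive_in.
have -> : diff_quot (fun s => f s + g s) t = (fun s => diff_quot f t s + diff_quot g t s).
  by apply/funext => s; rewrite /diff_quot; ring.
exact: cvgD.
Qed.

Lemma is_derive_in_cst A (c t : R) : is_derive_in A (fun=> c) t 0.
Proof.
rewrite /is_derive_in (_ : diff_quot _ _ = fun=> 0); first exact: cvg_cst.
by apply/funext => s; rewrite /diff_quot subrr mulr0.
Qed.

Lemma is_derive_in_mul A f g t l m : is_derive_in A f t l ->
  is_derive_in A g t m ->
  is_derive_in A (fun s => f s * g s) t (l * g t + f t * m).
Proof.
move=> fl gm; rewrite /is_derive_in.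
have -> : diff_quot (fun s => f s * g s) t =
    (fun s => diff_quot f t s * g s + f t * diff_quot g t s).
  by apply/funext => s; rewrite /diff_quot; ring.
apply: cvgD; first by apply: cvgM => //; exact: is_derive_in_cvg gm.
by apply: cvgM => //; exact: cvg_cst.
Qed.

Lemma is_derive_inT f (t l : R) : is_derive t 1 f l -> is_derive_in setT f t l.
Proof.
move=> [df <-]; rewrite /is_derive_in /diff_quot.
have H : (s - t) @[s --> within setT t^'] --> 0^'.
  move=> P [e /= e0 eP]; rewrite /within/=; exists e => //= s st ns _.
  by apply: eP => //=; rewrite ?sub0r ?opprB// subr_eq0.
apply: cvg_trans (df); apply: cvg_trans (cvg_app _ H).
rewrite -fmap_comp; apply: near_eq_cvg; apply: nearW => s /=.
by rewrite /GRing.scale/= mulr1 subrK.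
Qed.

(* Caratheodory's form of the derivative of g makes the chain rule a product
   of two limits. *)
Lemma is_derive_in_comp A f g t l m : is_derive_in A f t l ->
  is_derive_in setT g (f t) m -> is_derive_in A (fun s => g (f s)) t (m * l).
Proof.
move=> fl gm.
pose phi y := if y == f t then m else diff_quot g (f t) y.
have phic : phi @ f t --> m.
  apply/cvgrPdist_le => e e0; have /cvgrPdist_le/(_ e e0) := gm.
  rewrite near_withinE => -[d /= d0 dP]; exists d => //= y yd.
  rewrite /phi; case: eqVneq => [_|yt]; first by rewrite subrr normr0 ltW.
  exact: dP.
have : phi (f s) * diff_quot f t s @[s --> within A t^'] --> m * l.
  apply: cvgM => //.
  exact: (@cvg_comp _ _ _ f phi _ (nbhs (f t)) _ (is_derive_in_cvg fl)).
apply: cvg_trans; apply: near_eq_cvg.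
apply: filterS (dnbhs_within_neq A t) => s st.
rewrite /phi /diff_quot; case: eqVneq => [->|fst]; first by rewrite !subrr !mulr0.
by field; rewrite !subr_eq0 fst st.
Qed.

(** A bridge to the ordinary derivative, on which the mean value theorem and the fundamental theorem
    of calculus rest. *)
Lemma is_derive_in_oo (a b t : R) f l : t \in `]a, b[ ->
  is_derive_in `[a, b] f t l -> is_derive t 1 f l.
Proof.
move=> tab fl.
have H : h *: 1 + t @[h --> 0^'] --> within `[a, b]%classic t^'.
  move=> P [e /= e0 eP].
  have : nbhs t `]a, b[%classic by apply: open_nbhs_nbhs; split => //; exact: interval_open.
  move=> [e' /= e'0 e'P].
  exists (Num.min e e'); first by rewrite /= lt_min e0.
  move=> h /=; rewrite sub0r normrN lt_min => /andP[he he'] h0.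
  have htE : t - (h *: 1 + t) = - h by rewrite /GRing.scale/=; ring.
  apply: eP => /=.
  - by rewrite htE normrN.
  - by rewrite -subr_eq0 /GRing.scale/= mulr1 addrK.
  - have := e'P (h *: 1 + t); rewrite /= htE normrN => /(_ he').
    by apply: subset_itv_oo_cc.
have D : h^-1 *: ((f \o shift t) (h *: 1) - f t) @[h --> 0^'] --> l.
  apply: cvg_trans fl; apply: cvg_trans (cvg_app _ H).
  rewrite -fmap_comp; apply: near_eq_cvg; apply: nearW => h /=.
  by rewrite /diff_quot /GRing.scale/= addrK mulr1.
by split; [apply/cvg_ex; exists l|exact: cvg_lim D].
Qed.

Lemma MVT_in_le (a b : R) f df (s t : R) :
  (forall r, r \in `[a, b] -> is_derive_in `[a, b] f r (df r)) ->
  a <= s -> s <= t -> t <= b ->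
  exists2 c, c \in `[s, t] & f t - f s = df c * (t - s).
Proof.
move=> fdf as_ st tb.
have cc r : r \in `[s, t] -> r \in `[a, b].
  by rewrite !in_itv/= => /andP[? ?]; rewrite (le_trans as_)// (le_trans _ tb).
apply: MVT_segment => //.
- move=> r rst; apply: (@is_derive_in_oo a b).
    move: rst; rewrite !in_itv/= => /andP[? ?].
    by rewrite (le_lt_trans as_)// (lt_le_trans _ tb).
  by apply: fdf; apply: cc; exact: subset_itv_oo_cc rst.
- apply/subspace_continuousP => r /= rst.
  have := is_derive_in_cvg_within (fdf r (cc r rst)).
  by apply: cvg_trans; apply: cvg_app; apply: within_subset => x /=; exact: cc.
Qed.

(** The order of s and t is left open and only the distance from c to t is recorded, which suits
    limits as s tends to t from either side. *)
Lemma MVT_in (a b : R) f df (s t : R) :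
  (forall r, r \in `[a, b] -> is_derive_in `[a, b] f r (df r)) ->
  s \in `[a, b] -> t \in `[a, b] ->
  exists c, [/\ c \in `[a, b], `|c - t| <= `|s - t| & f s - f t = df c * (s - t)].
Proof.
move=> fdf; rewrite !in_itv/= => /andP[as_ sb] /andP[at_ tb].
have [st|/ltW ts] := leP s t.
- have [c] := MVT_in_le fdf as_ st tb; rewrite in_itv/= => /andP[sc ct] E.
  exists c; split.
  + by rewrite in_itv/= (le_trans as_)// (le_trans ct).
  + by rewrite !ler0_norm ?subr_le0// lerN2 lerB.
  + by rewrite -opprB E -mulrN opprB.
- have [c] := MVT_in_le fdf at_ ts sb; rewrite in_itv/= => /andP[tc cs] E.
  exists c; split => //.
  + by rewrite in_itv/= (le_trans at_)// (le_trans cs).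
  + by rewrite !ger0_norm ?subr_ge0// lerB.
Qed.

End relative_derivative.

(** * Differentiation under the integral sign *)

Section derivation_under_cube_int.
Context {R : realType} {d : nat}.

(** By the mean value theorem the difference quotient at y equals [dF c y] for some c between s and
    t. Joint continuity and compactness make this uniformly close to [dF t y], although c depends on
    y. *)
Lemma is_derive_in_cube_int (a b t : R) (F dF : R -> 'rV[R]_d -> R) :
  t \in `[a, b] ->
  (forall s, s \in `[a, b] -> continuous (F s)) ->
  (forall s, s \in `[a, b] -> continuous (dF s)) ->
  (forall s y, s \in `[a, b] -> is_derive_in `[a, b] (F ^~ y) s (dF s y)) ->
  (forall y, unit_cube y -> dF p.2 p.1 @[p --> filter_prod (nbhs y)
     (within `[a, b]%classic (nbhs t))] --> dF t y) ->
  is_derive_in `[a, b] (fun s => cube_int (F s)) t (cube_int (dF t)).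
Proof.
move=> tab cF cdF FdF jdF.
have HJ := @cube_int_mean R d; have [JD JZ Jle Jc] := HJ.
(* Differences are written with a factor -1 because [mean_on_continuous] speaks only of sums and
   multiples. *)
have copp (f : 'rV[R]_d -> R) : continuous f -> continuous (fun y => -1 * f y).
  by move=> cf; apply: continuous_mul => //; exact: continuous_cst.
have cq s : s \in `[a, b] ->
    continuous (fun y => (s - t)^-1 * (F s y + -1 * F t y)).
  move=> sab; apply: continuous_mul; first exact: continuous_cst.
  by apply: continuous_add; [exact: cF|apply: copp; exact: cF].
have : cube_int (fun y => (s - t)^-1 * (F s y + -1 * F t y))
    @[s --> within `[a, b]%classic t^'] --> cube_int (dF t).
  apply: mean_cvg => //; last first.
  - move=> e e0.
    have := near_unit_cube (cdF t tab) jdF e0.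
    rewrite !near_withinE => -[dl /= dl0 dlP]; exists dl => //= s sd st sab y Ky.
    have [c [cab ct E]] := MVT_in (FdF ^~ y) sab tab.
    rewrite mulN1r E mulrCA mulVf ?subr_eq0// mulr1; apply: dlP => //.
    by rewrite /= distrC (le_lt_trans ct)// distrC.
  - exact: cdF.
  - by rewrite near_withinE; near=> s => /= sab; exact: cq.
apply: cvg_trans; apply: near_eq_cvg; rewrite near_withinE; near=> s => /= sab.
rewrite /diff_quot JZ; last first.
  by apply: continuous_add; [exact: cF|apply: copp; exact: cF].
rewrite JD; [|exact: cF|by apply: copp; exact: cF].
by rewrite JZ ?mulN1r//; exact: cF.
Unshelve. all: by end_near. Qed.

End derivation_under_cube_int.

Section derivative_along_lines.
Context {R : realType} {V : normedModType R}.
Implicit Types (f : V -> R) (x v : V).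

(** Together with its converse at 0, [line_is_derive], this reduces directional derivatives to the
    one-variable rules above. *)
Lemma is_derive_line (A : set R) f x v (r l : R) :
  is_derive (r *: v + x) v f l -> is_derive_in A (fun s => f (s *: v + x)) r l.
Proof.
move=> [df <-]; rewrite /is_derive_in /diff_quot.
have H : (s - r) @[s --> within A r^'] --> 0^'.
  move=> P [e /= e0 eP]; rewrite /within/=; exists e => //= s st ns _.
  by apply: eP => //=; rewrite ?sub0r ?opprB// subr_eq0.
apply: cvg_trans (df); apply: cvg_trans (cvg_app _ H).
rewrite -fmap_comp; apply: near_eq_cvg; apply: nearW => s /=.
by rewrite addrA -scalerDl subrK.
Qed.

Lemma line_is_derive f x v (l : R) :
  is_derive_in setT (fun s => f (s *: v + x)) 0 l -> is_derive x v f l.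
Proof.
move=> fl.
have D : h^-1 *: ((f \o shift x) (h *: v) - f x) @[h --> 0^'] --> l.
  have H : (0 : R)^' --> within setT (0 : R)^'.
    by move=> P [e e0 eP]; exists e => // h he h0; exact: eP.
  apply: cvg_trans fl; apply: cvg_trans (cvg_app _ H).
  apply: near_eq_cvg; apply: nearW => h /=.
  by rewrite /diff_quot subr0 scale0r add0r.
by split; [apply/cvg_ex; exists l|exact: cvg_lim D].
Qed.

End derivative_along_lines.

(** * Integral of a partial derivative over the cube *)

Section cube_int_partial.
Context {R : realType}.

Lemma row_mx_scalar_split d (s : R) (y : 'rV[R]_d) :
  row_mx (s%:M : 'rV[R]_1) y =
    s *: basis_vec (lshift d ord0) + row_mx (0 : 'rV[R]_1) y.
Proof.
apply/rowP => j; rewrite [RHS]mxE [X in _ = X + _]mxE.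
case: (@split_ordP 1 d j) => k ->; rewrite ?row_mxEl ?row_mxEr.
  by rewrite (ord1 k) !mxE eqxx mulr1 addr0.
by rewrite mxE eqxx eq_rlshift mulr0 add0r.
Qed.

Lemma row_mx_basis d (s h : R) (y : 'rV[R]_d) (k : 'I_d) :
  row_mx (s%:M : 'rV[R]_1) (h *: basis_vec k + y) =
    h *: basis_vec (rshift 1 k) + row_mx (s%:M : 'rV[R]_1) y.
Proof.
apply/rowP => j; rewrite [RHS]mxE [X in _ = X + _]mxE.
case: (@split_ordP 1 d j) => i ->; rewrite ?row_mxEl ?row_mxEr.
  by rewrite [X in _ * X]mxE eqxx eq_lrshift mulr0 add0r.
by rewrite !mxE eqxx (inj_eq (@rshift_inj 1 d)).
Qed.

(* The first coordinate is handled by the fundamental theorem of calculus after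
   differentiating under the inner integrals; the others vanish slice by slice. *)
Lemma cube_int_partial_eq0 d (f df : 'rV[R]_d -> R) (j : 'I_d) :
  continuous f -> continuous df ->
  (forall y, is_derive y (basis_vec j) f (df y)) ->
  (forall y, f (y + basis_vec j) = f y) -> cube_int df = 0.
Proof.
elim: d f df j => [|d IH] f df j; first by case: j.
move=> cf cdf fdf pf; case: (@split_ordP 1 d j) pf fdf => k -> pf fdf /=.
- rewrite (ord1 k) in pf fdf.
  pose F s := cube_int (fun y : 'rV[R]_d => f (row_mx (s%:M : 'rV[R]_1) y)).
  pose G s := cube_int (fun y : 'rV[R]_d => df (row_mx (s%:M : 'rV[R]_1) y)).
  have FG (s : R) : s \in `[0, 1] -> is_derive_in `[0, 1] F s (G s).
    move=> s01; apply: (@is_derive_in_cube_int R d 0 1 s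
      (fun r y => f (row_mx (r%:M : 'rV[R]_1) y))
      (fun r y => df (row_mx (r%:M : 'rV[R]_1) y))) => //.
    + by move=> r _; exact: slice_continuous.
    + by move=> r _; exact: slice_continuous.
    + move=> r y _.
      have -> : (fun s0 : R => f (row_mx (s0%:M : 'rV[R]_1) y)) =
          (fun s0 => f (s0 *: basis_vec (lshift d ord0) + row_mx (0 : 'rV[R]_1) y)).
        by apply/funext => s0; rewrite row_mx_scalar_split.
      by apply: is_derive_line; rewrite row_mx_scalar_split; exact: fdf.
    + move=> y _; apply: cvg_comp_row_mx => //; last exact: cvg_fst.
      apply: cvg_trans cvg_snd _; exact: cvg_within.
  have cF : continuous F by exact: mean_slice_continuous (cube_int_mean d) cf.
  have cG : continuous G by exact: mean_slice_continuous (cube_int_mean d) cdf.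
  (* The integral of [G] is [F 1 - F 0], which vanishes by periodicity in the first coordinate. *)
  rewrite /Rintegral (@continuous_FTC2 _ G F 0 1) ?ltr01//=.
  + rewrite (_ : F 1 = F 0) ?subrr//; congr cube_int; apply/funext => y.
    rewrite row_mx_scalar_split scale1r addrC pf.
    by rewrite row_mx_scalar_split scale0r add0r.
  + exact: continuous_subspaceT.
  + split.
    * move=> s s01; have /FG/(is_derive_in_oo s01) [] // : s \in `[0, 1].
      exact: subset_itv_oo_cc s01.
    * by apply: cvg_at_right_filter; exact: cF.
    * by apply: cvg_at_left_filter; exact: cF.
  + move=> s s01; have /FG/(is_derive_in_oo s01) [_] : s \in `[0, 1].
      exact: subset_itv_oo_cc s01.
    by rewrite derive1E.
- have E (s : R) : cube_int (fun y : 'rV[R]_d => df (row_mx (s%:M : 'rV[R]_1) y)) = 0.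
    apply: (IH (fun y => f (row_mx (s%:M : 'rV[R]_1) y)) _ k).
    + exact: slice_continuous.
    + exact: slice_continuous.
    + move=> y; apply: line_is_derive.
      have -> : (fun h : R => f (row_mx (s%:M : 'rV[R]_1) (h *: basis_vec k + y))) =
          (fun h => f (h *: basis_vec (rshift 1 k) + row_mx (s%:M : 'rV[R]_1) y)).
        by apply/funext => h; rewrite row_mx_basis.
      by apply: is_derive_line; rewrite scale0r add0r; exact: fdf.
    + move=> y; rewrite addrC -[basis_vec k]scale1r row_mx_basis scale1r addrC.
      exact: pf.
  under eq_Rintegral do rewrite E.
  by rewrite Rintegral_cst ?mul0r//; exact: measurable_itv.
Qed.

End cube_int_partial.

(** * Directional derivatives *)

Section directional_derivatives.
Context {R : realType} {V : normedModType R}.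
Implicit Types (f g : V -> R) (x v w : V).

Lemma continuous_small_shift g x v w (e : R) : {for x, continuous g} -> 0 < e ->
  exists2 del : R, 0 < del & forall c c' : R, `|c| <= del -> `|c'| <= del ->
    `|g (c' *: w + (c *: v + x)) - g x| <= e.
Proof.
move=> /cvgrPdist_le/(_ e) cg /cg/nbhs_ballP[r /= r0 rP].
(* The added 1 keeps the denominator positive when v and w both vanish. *)
have K0 : 0 < `|v| + `|w| + 1 by rewrite ltr_wpDl// addr_ge0.
exists (r / 2 / (`|v| + `|w| + 1)); first by rewrite !divr_gt0.
move=> c c' cd cd'; rewrite distrC; apply: rP.
rewrite -ball_normE/= distrC addrA addrK.
rewrite (le_lt_trans (ler_normD _ _))// !normrZ.
apply: (@le_lt_trans _ _ (r / 2)); last by rewrite ltr_pdivrMr// ltr_pMr// ltr1n.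
apply: (@le_trans _ _ (r / 2 / (`|v| + `|w| + 1) * (`|v| + `|w|))).
  by rewrite mulrDr addrC lerD// ler_wpM2r.
rewrite -mulrA ler_piMr ?divr_ge0 ?(ltW r0)// mulrC ler_pdivrMr// mul1r.
by rewrite lerDl.
Qed.

Lemma MVT_line f (df : V -> R) x v (h : R) : (forall y, is_derive y v f (df y)) ->
  exists2 c : R, `|c| <= `|h| & f (h *: v + x) - f x = h * df (c *: v + x).
Proof.
move=> fdf.
have := @MVT_in R (- `|h|) `|h| (fun s => f (s *: v + x)) (fun s => df (s *: v + x)) h 0.
case.
- by move=> r _; exact: is_derive_line.
- by rewrite in_itv/= -ler_norml.
- by rewrite in_itv/= oppr_le0 normr_ge0.
- move=> c [_]; rewrite !subr0 scale0r add0r => ch E.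
  by exists c => //; rewrite E mulrC.
Qed.

(** Additivity in the direction fails for mere directional derivatives. Here the increment is split
    into a step along v and then one along w; the mean value theorem and the continuity of [dw]
    control the second step. *)
Lemma is_derive_add_direction f (dv dw : V -> R) x v w :
  (forall y, is_derive y v f (dv y)) -> (forall y, is_derive y w f (dw y)) ->
  {for x, continuous dw} -> is_derive x (v + w) f (dv x + dw x).
Proof.
move=> fv fw cw; apply: line_is_derive.
have fv' : is_derive_in setT (fun s => f (s *: v + x)) 0 (dv x).
  by apply: is_derive_line; rewrite scale0r add0r; exact: fv.
have : diff_quot (fun s => f (s *: v + x)) 0 s +
    s^-1 * (f (s *: w + (s *: v + x)) - f (s *: v + x))
    @[s --> within setT (0 : R)^'] --> dv x + dw x.
  apply: cvgD => //; apply/cvgrPdist_le => e e0.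
  have [dl dl0 dlP] := @continuous_small_shift dw x v w e cw e0.
  rewrite near_withinE; exists dl => //= s; rewrite /= sub0r normrN => sd s0 _.
  have [c cs ->] := @MVT_line f dw (s *: v + x) w s fw.
  rewrite mulKf// distrC; apply: dlP; first exact: ltW.
  by rewrite (le_trans cs)// ltW.
apply: cvg_trans; apply: near_eq_cvg; apply: nearW => s.
rewrite /diff_quot !scale0r !add0r subr0 -mulrDr; congr (_ * _).
have -> : s *: (v + w) + x = s *: w + (s *: v + x).
  by rewrite scalerDr [s *: v + s *: w]addrC -addrA.
by ring.
Qed.

(** The chain rule for s mapped to s c covers c = 0 without a case distinction. *)
Lemma is_derive_scale_direction f x v (l c : R) :
  is_derive x v f l -> is_derive x (c *: v) f (c * l).
Proof.
move=> fl; apply: line_is_derive.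
have -> : (fun s => f (s *: (c *: v) + x)) = (fun s => f ((s * c) *: v + x)).
  by apply/funext => s; rewrite scalerA.
rewrite mulrC; apply: (@is_derive_in_comp _ _ (fun s => s * c) (fun r => f (r *: v + x))).
  rewrite -[X in is_derive_in _ _ _ X]mul1r -[1 * c]addr0 -{2}(mul0r 0).
  apply: (@is_derive_in_mul _ _ id (fun=> c)); last exact: is_derive_in_cst.
  by apply: is_derive_inT; exact: is_derive_id.
by apply: is_derive_line; rewrite mul0r scale0r add0r.
Qed.

Lemma is_derive_sum_direction (I : finType) (c : I -> R) (e : I -> V) f
    (df : I -> V -> R) x :
  (forall i, continuous (df i)) ->
  (forall i y, is_derive y (e i) f (df i y)) ->
  is_derive x (\sum_i c i *: e i) f (\sum_i c i * df i x).
Proof.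
move=> cdf fdf.
elim: (index_enum I) x => [|i s IH] x.
  by rewrite !big_nil; exact: is_derive0.
(* The single new direction is moved to second place, where continuity of the derivative is
   required. *)
rewrite !big_cons addrC [X in is_derive _ _ _ X]addrC.
apply: (@is_derive_add_direction f _ (fun y => c i * df i y)) => //.
- by move=> y; exact: is_derive_scale_direction.
- by apply: continuous_mul => //; exact: continuous_cst.
Qed.

(** The mean value theorem is applied along v to the increment f (h w + y) - f y, and then along w
    to [fv]. *)
Lemma second_difference f (fv fvw : V -> R) x v w (h : R) :
  (forall y, is_derive y v f (fv y)) -> (forall y, is_derive y w fv (fvw y)) ->
  exists c c' : R, [/\ `|c| <= `|h|, `|c'| <= `|h| &
    f (h *: v + (h *: w + x)) - f (h *: w + x) - (f (h *: v + x) - f x) =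
    h * (h * fvw (c' *: w + (c *: v + x)))].
Proof.
move=> dv dw.
have dphi y : is_derive y v (fun y => f (h *: w + y) - f y) (fv (h *: w + y) - fv y).
  apply: is_deriveB; apply: line_is_derive.
  have -> : (fun s : R => f (h *: w + (s *: v + y))) = (fun s => f (s *: v + (h *: w + y))).
    by apply/funext => s; rewrite addrCA.
  by apply: is_derive_line; rewrite scale0r add0r; exact: dv.
have [c ch E] := @MVT_line _ _ x v h dphi.
have [c' ch' E'] := @MVT_line fv fvw (c *: v + x) w h dw.
exists c, c'; split => //.
by rewrite -E' -E [h *: v + (_ + _)]addrCA opprB; ring.
Qed.

(** Schwarz's argument: the second difference is symmetric in v and w, so both mixed derivatives
    take a common value at points arbitrarily close to x. *)
Lemma mixed_derivatives_commute f (fv fw fvw fwv : V -> R) x v w :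
  (forall y, is_derive y v f (fv y)) -> (forall y, is_derive y w f (fw y)) ->
  (forall y, is_derive y w fv (fvw y)) -> (forall y, is_derive y v fw (fwv y)) ->
  {for x, continuous fvw} -> {for x, continuous fwv} -> fvw x = fwv x.
Proof.
move=> dv dw dvw dwv cvw cwv; apply/eqP; rewrite -subr_eq0 -normr_eq0.
rewrite eq_le normr_ge0 andbT; apply/ler_addgt0Pr => e e0; rewrite add0r.
have e2 : 0 < e / 2 by rewrite divr_gt0.
have [d1 d10 d1P] := continuous_small_shift v w cvw e2.
have [d2 d20 d2P] := continuous_small_shift w v cwv e2.
pose h := Num.min d1 d2.
have h0 : 0 < h by rewrite lt_min d10.
have hd1 (c : R) : `|c| <= `|h| -> `|c| <= d1.
  by move=> /le_trans; apply; rewrite gtr0_norm// ge_min lexx.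
have hd2 (c : R) : `|c| <= `|h| -> `|c| <= d2.
  by move=> /le_trans; apply; rewrite gtr0_norm// ge_min lexx orbT.
have [c [c' [cd cd' E1]]] := @second_difference f fv fvw x v w h dv dvw.
have [k [k' [kd kd' E2]]] := @second_difference f fw fwv x w v h dw dwv.
have E : fvw (c' *: w + (c *: v + x)) = fwv (k' *: v + (k *: w + x)).
  apply: (mulfI (lt0r_neq0 h0)); apply: (mulfI (lt0r_neq0 h0)).
  by rewrite -E1 -E2 [h *: v + (_ + _)]addrCA; ring.
have := lerD (d1P _ _ (hd1 _ cd) (hd1 _ cd')) (d2P _ _ (hd2 _ kd) (hd2 _ kd')).
rewrite -splitr; apply: le_trans.
rewrite E [leRHS]addrC; set z := fwv (_ + _).
rewrite (_ : fvw x - fwv x = (z - fwv x) - (z - fvw x)); last by ring.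
exact: ler_normB.
Qed.

End directional_derivatives.

(** * Smooth functions on the torus *)

Section torus_integral.
Context {R : realType} {d : nat} (B : 'M[R]_d).
Implicit Types f g : 'rV[R]_d -> R.

Lemma continuous_mulmxr : continuous (fun y : 'rV[R]_d => y *m B).
Proof.
move=> y; apply: (@cvg_rV R d _ (nbhs y)) => j; rewrite mxE.
under eq_fun do rewrite mxE.
apply: (@continuous_sumr R 'rV[R]_d 'I_d (fun k z => z 0 k * B k j)) => k.
apply: continuous_mul; last exact: continuous_cst.
exact: coord_continuous.
Qed.

Lemma continuous_comp_mulmx f : continuous f ->
  continuous (fun y : 'rV[R]_d => f (y *m B)).
Proof.
move=> cf y; apply: (@continuous_comp _ _ _ (fun y : 'rV[R]_d => y *m B) f y).
  exact: continuous_mulmxr.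
exact: cf.
Qed.

Lemma torus_int_add f g : continuous f -> continuous g ->
  torus_int B (fun x => f x + g x) = torus_int B f + torus_int B g.
Proof.
move=> cf cg; have [JD _ _ _] := @cube_int_mean R d.
by rewrite /torus_int JD ?mulrDr//; exact: continuous_comp_mulmx.
Qed.

Lemma torus_int_scale (c : R) f : continuous f ->
  torus_int B (fun x => c * f x) = c * torus_int B f.
Proof.
move=> cf; have [_ JZ _ _] := @cube_int_mean R d.
by rewrite /torus_int JZ 1?mulrCA//; exact: continuous_comp_mulmx.
Qed.

Lemma torus_int_sum (I : finType) (f : I -> 'rV[R]_d -> R) :
  (forall i, continuous (f i)) ->
  torus_int B (fun x => \sum_i f i x) = \sum_i torus_int B (f i).
Proof.
move=> cf.
suff H s : torus_int B (fun x => \sum_(i <- s) f i x) = \sum_(i <- s) torus_int B (f i) /\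
    continuous (fun x => \sum_(i <- s) f i x) by exact: (H _).1.
elim: s => [|i s [IH cs]].
  under eq_fun do rewrite big_nil; rewrite big_nil; split; last exact: continuous_cst.
  have [_ _ _ Jc] := @cube_int_mean R d.
  by rewrite /torus_int Jc mulr0.
under eq_fun do rewrite big_cons; rewrite big_cons; split.
  by rewrite torus_int_add// IH.
exact: continuous_add.
Qed.

Lemma torus_int_ge0 f : continuous f -> (forall x, 0 <= f x) ->
  0 <= torus_int B f.
Proof.
move=> cf f0; have [_ _ Jle Jc] := @cube_int_mean R d.
rewrite /torus_int mulr_ge0// -[leLHS](Jc 0); apply: Jle => //.
  exact: continuous_cst.
exact: continuous_comp_mulmx.
Qed.

(** The periods of f are the rows of [B], not the basis vectors. Pulled back to the cube by [B], a
    partial derivative becomes a derivative along a row, whose integral vanishes; [invmx B] recovers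
    the basis directions from the rows. *)
Lemma torus_int_partial_eq0 f (df : 'I_d -> 'rV[R]_d -> R) i : B \in unitmx ->
  periodic B f -> continuous f -> (forall k, continuous (df k)) ->
  (forall k x, is_derive x (basis_vec k) f (df k x)) ->
  torus_int B (df i) = 0.
Proof.
move=> uB pf cf cdf fdf.
(* [q j] is the derivative of f along row j of [B], by linearity in the direction. *)
pose q j x := \sum_k B j k * df k x.
have cq j : continuous (q j).
  by apply: continuous_sumr => k; apply: continuous_mul => //; exact: continuous_cst.
have -> : df i = (fun x => \sum_j invmx B i j * q j x).
  apply/funext => x; rewrite /q.
  under eq_bigr do rewrite mulr_sumr.
  rewrite exchange_big/=.
  have E k : \sum_j invmx B i j * (B j k * df k x) = (i == k)%:R * df k x.
    under eq_bigr do rewrite mulrA.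
    have := congr1 (fun M : 'M[R]_d => M i k) (mulVmx uB).
    by rewrite !mxE -mulr_suml => ->.
  under eq_bigr do rewrite E.
  rewrite (bigD1 i)//= eqxx mul1r big1 ?addr0// => k ki.
  by rewrite eq_sym (negbTE ki) mul0r.
rewrite torus_int_sum; last first.
  by move=> j; apply: continuous_mul => //; exact: continuous_cst.
apply: big1 => j _; rewrite torus_int_scale// /torus_int.
suff -> : cube_int (fun y => q j (y *m B)) = 0 by rewrite !mulr0.
apply: (@cube_int_partial_eq0 R d (fun y => f (y *m B)) _ j).
- exact: continuous_comp_mulmx.
- exact: continuous_comp_mulmx.
- move=> y; apply: line_is_derive.
  have -> : (fun s : R => f ((s *: basis_vec j + y) *m B)) =
      (fun s => f (s *: (\sum_k B j k *: basis_vec k) + y *m B)).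
    apply/funext => s; rewrite mulmxDl -scalemxAl -rowE.
    by rewrite [in LHS](row_sum_delta (row j B)); under eq_bigr do rewrite mxE.
  apply: is_derive_line; rewrite scale0r add0r.
  exact: is_derive_sum_direction.
- move=> y; rewrite mulmxDl; apply: pf.
  exists (delta_mx 0 j) => //; congr (_ *m _).
  by apply/matrixP => a b; rewrite !mxE; case: (_ && _).
Qed.

End torus_integral.

(** * Calculus of smooth periodic functions *)

Section smooth_periodic.
Context {R : realType} {d : nat} (B : 'M[R]_d).
Implicit Types f g : 'rV[R]_d -> R.

Definition pd (i : 'I_d) f : 'rV[R]_d -> R := fun x => 'D_(basis_vec i) f x.

(** Counting the order lets closure under products and inverses be proved by induction: the
    derivative of a product or an inverse again contains the undifferentiated functions, but at one
    order less. *)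
Fixpoint Cn_periodic (n : nat) f : Prop :=
  [/\ continuous f, periodic B f &
    if n is m.+1 then forall i,
      (forall x, derivable f x (basis_vec i)) /\ Cn_periodic m (pd i f)
    else True].

Definition smooth_periodic f := forall n, Cn_periodic n f.

Lemma Cn_periodicW n f : Cn_periodic n.+1 f -> Cn_periodic n f.
Proof.
elim: n f => [|n IH] f; first by case.
move=> [cf pf H]; split => // i; have [df cdf] := H i; split => //.
exact: IH.
Qed.

Lemma Cn_periodic_cst n (c : R) : Cn_periodic n (fun=> c).
Proof.
elim: n c => [|n IH] c; split => //; try exact: continuous_cst.
move=> i; split; first by move=> x; exact: derivable_cst.
rewrite (_ : pd i _ = fun=> 0)//; apply/funext => x; exact: derive_cst.
Qed.

Lemma pd_cst i (c : R) x : pd i (fun=> c) x = 0.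
Proof. exact: derive_cst. Qed.

Lemma pd_add i f g x : derivable f x (basis_vec i) -> derivable g x (basis_vec i) ->
  pd i (fun x => f x + g x) x = pd i f x + pd i g x.
Proof. exact: deriveD. Qed.

Lemma pd_mul i f g x : derivable f x (basis_vec i) -> derivable g x (basis_vec i) ->
  pd i (fun x => f x * g x) x = pd i f x * g x + f x * pd i g x.
Proof. by move=> df dg; rewrite /pd deriveM// addrC mulrC. Qed.

Lemma pd_inv i f x : derivable f x (basis_vec i) -> f x != 0 ->
  pd i (fun x => (f x)^-1) x = -1 * (pd i f x * ((f x)^-1 * (f x)^-1)).
Proof.
move=> df f0; rewrite /pd deriveV// /GRing.scale/= expr2 invfM; ring.
Qed.

Lemma is_derive_ln_comp (v : 'rV[R]_d) f x (l : R) : 0 < f x ->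
  is_derive x v f l -> is_derive x v (fun x => ln (f x)) (l * (f x)^-1).
Proof.
move=> f0 dl; apply: line_is_derive; rewrite mulrC.
have E : f (0 *: v + x) = f x by rewrite scale0r add0r.
apply: (@is_derive_in_comp R _ (fun s => f (s *: v + x)) (@ln R)).
  by apply: is_derive_line; rewrite scale0r add0r.
by rewrite E; apply: is_derive_inT; exact: is_derive1_ln.
Qed.

Lemma pd_ln i f x : derivable f x (basis_vec i) -> 0 < f x ->
  pd i (fun x => ln (f x)) x = pd i f x * (f x)^-1.
Proof.
move=> /derivableP df f0; rewrite /pd.
by have [_ ->] := is_derive_ln_comp f0 df.
Qed.

Lemma Cn_periodic_add n f g : Cn_periodic n f -> Cn_periodic n g ->
  Cn_periodic n (fun x => f x + g x).
Proof.
elim: n f g => [|n IH] f g [cf pf Hf] [cg pg Hg]; split => //.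
- exact: continuous_add.
- by move=> x v Lv; rewrite pf// pg.
- exact: continuous_add.
- by move=> x v Lv; rewrite pf// pg.
- move=> i; have [df cdf] := Hf i; have [dg cdg] := Hg i; split.
    by move=> x; exact: derivableD.
  rewrite (_ : pd i _ = fun x => pd i f x + pd i g x); first exact: IH.
  by apply/funext => x; exact: pd_add.
Qed.

Lemma Cn_periodic_mul n f g : Cn_periodic n f -> Cn_periodic n g ->
  Cn_periodic n (fun x => f x * g x).
Proof.
elim: n f g => [|n IH] f g [cf pf Hf] [cg pg Hg]; split => //.
- exact: continuous_mul.
- by move=> x v Lv; rewrite pf// pg.
- exact: continuous_mul.
- by move=> x v Lv; rewrite pf// pg.
- move=> i; have [df cdf] := Hf i; have [dg cdg] := Hg i; split.
    by move=> x; exact: derivableM.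
  rewrite (_ : pd i _ = fun x => pd i f x * g x + f x * pd i g x).
    by apply: Cn_periodic_add; apply: IH => //; exact: Cn_periodicW.
  by apply/funext => x; exact: pd_mul.
Qed.

Lemma Cn_periodic_inv n f : (forall x, f x != 0) -> Cn_periodic n f ->
  Cn_periodic n (fun x => (f x)^-1).
Proof.
move=> f0; elim: n => [|n IH] [cf pf Hf]; split => //.
- exact: continuous_inv.
- by move=> x v Lv; rewrite pf.
- exact: continuous_inv.
- by move=> x v Lv; rewrite pf.
- move=> i; have [df cdf] := Hf i; split.
    by move=> x; exact: derivableV.
  rewrite (_ : pd i _ = fun x => -1 * (pd i f x * ((f x)^-1 * (f x)^-1))).
    apply: Cn_periodic_mul; first exact: Cn_periodic_cst.
    apply: Cn_periodic_mul => //.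
    by apply: Cn_periodic_mul; apply: IH; exact: Cn_periodicW.
  by apply/funext => x; exact: pd_inv.
Qed.

Lemma Cn_periodic_ln n f : (forall x, 0 < f x) -> Cn_periodic n f ->
  Cn_periodic n (fun x => ln (f x)).
Proof.
move=> f0; case: n => [|n] [cf pf Hf]; split => //.
- exact: continuous_ln_comp.
- by move=> x v Lv; rewrite pf.
- exact: continuous_ln_comp.
- by move=> x v Lv; rewrite pf.
- move=> i; have [df cdf] := Hf i; split.
    by move=> x; have /derivableP/(is_derive_ln_comp (f0 x)) [] := df x.
  rewrite (_ : pd i _ = fun x => pd i f x * (f x)^-1).
    apply: Cn_periodic_mul => //.
    apply: Cn_periodic_inv; first by move=> x; rewrite gt_eqF.
    exact: Cn_periodicW.
  by apply/funext => x; exact: pd_ln.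
Qed.

Lemma smooth_cst (c : R) : smooth_periodic (fun=> c).
Proof. by move=> n; exact: Cn_periodic_cst. Qed.

Lemma smooth_add f g : smooth_periodic f -> smooth_periodic g ->
  smooth_periodic (fun x => f x + g x).
Proof. by move=> sf sg n; exact: Cn_periodic_add. Qed.

Lemma smooth_mul f g : smooth_periodic f -> smooth_periodic g ->
  smooth_periodic (fun x => f x * g x).
Proof. by move=> sf sg n; exact: Cn_periodic_mul. Qed.

Lemma smooth_inv f : (forall x, f x != 0) -> smooth_periodic f ->
  smooth_periodic (fun x => (f x)^-1).
Proof. by move=> f0 sf n; exact: Cn_periodic_inv. Qed.

Lemma smooth_ln f : (forall x, 0 < f x) -> smooth_periodic f ->
  smooth_periodic (fun x => ln (f x)).
Proof. by move=> f0 sf n; exact: Cn_periodic_ln. Qed.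

Lemma smooth_pd i f : smooth_periodic f -> smooth_periodic (pd i f).
Proof. by move=> sf n; have [_ _ /(_ i)[]] := sf n.+1. Qed.

Lemma smooth_derivable f x i : smooth_periodic f -> derivable f x (basis_vec i).
Proof. by move=> sf; have [_ _ /(_ i)[]] := sf 1. Qed.

Lemma smooth_continuous f : smooth_periodic f -> continuous f.
Proof. by move=> sf; have [] := sf 0. Qed.

Lemma smooth_sum (I : finType) (f : I -> 'rV[R]_d -> R) :
  (forall i, smooth_periodic (f i)) -> smooth_periodic (fun x => \sum_i f i x).
Proof.
move=> sf; elim: (index_enum I) => [|i s IH].
  by under eq_fun do rewrite big_nil; exact: smooth_cst.
by under eq_fun do rewrite big_cons; exact: smooth_add.
Qed.

Lemma torus_int_pd i f : B \in unitmx -> smooth_periodic f ->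
  torus_int B (pd i f) = 0.
Proof.
move=> uB sf; apply: (@torus_int_partial_eq0 R d B f (fun k => pd k f)) => //.
- by have [] := sf 0.
- exact: smooth_continuous.
- by move=> k; apply: smooth_continuous; exact: smooth_pd.
- by move=> k x; apply: derivableP; exact: smooth_derivable.
Qed.

Lemma pd_commute i j f x : smooth_periodic f -> pd i (pd j f) x = pd j (pd i f) x.
Proof.
move=> sf; have dP k g y : smooth_periodic g -> is_derive y (basis_vec k) g (pd k g y).
  by move=> sg; apply: derivableP; exact: smooth_derivable.
apply: (@mixed_derivatives_commute _ _ f (pd j f) (pd i f)).
- by move=> y; exact: dP.
- by move=> y; exact: dP.
- by move=> y; apply: dP; exact: smooth_pd.
- by move=> y; apply: dP; exact: smooth_pd.
- by apply: smooth_continuous; do 2 apply: smooth_pd.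
- by apply: smooth_continuous; do 2 apply: smooth_pd.
Qed.

Definition laplacian f : 'rV[R]_d -> R := fun x => \sum_i pd i (pd i f) x.

(** This is div (f grad f) expanded by the product rule, a form that splits into a sum over
    coordinates. *)
Definition flow f : 'rV[R]_d -> R :=
  fun x => \sum_i (pd i f x * pd i f x + f x * pd i (pd i f) x).

Lemma div_flux f x : smooth_periodic f ->
  div (fun y => f y *: grad f y) x = flow f x.
Proof.
move=> sf; apply: eq_bigr => i _.
rewrite -pd_mul; [|exact: smooth_derivable|by apply: smooth_derivable; exact: smooth_pd].
by congr ('D_(basis_vec i) _ x); apply/funext => y; rewrite !mxE.
Qed.

End smooth_periodic.

(** * Time-dependent functions on the torus *)

Section time_dependent.
Context {R : realType} {d : nat} (T : R) (B : 'M[R]_d).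
Implicit Types u v : R -> 'rV[R]_d -> R.

(** Space comes first in the pair, to match the product filter used for uniformity over the cube. *)
Definition jointly_continuous u := forall (t : R) x, t \in `[0, T] ->
  u p.2 p.1 @[p --> filter_prod (nbhs x) (within `[0, T]%classic (nbhs t))] --> u t x.

Lemma within_jointly_continuous u :
  {within `[0, T] `*` [set: 'rV[R]_d],
    continuous (fun p : R * 'rV[R]_d => u p.1 p.2)} -> jointly_continuous u.
Proof.
move=> /subspace_continuousP cu t x tI A Au.
have [[P Q] /= [Pt Qx] PQ] := cu (t, x) (conj tI I) A Au.
exists (Q, `[0, T]%classic `&` P) => /=.
  by split => //; apply: (@filterS _ (nbhs t) _ P) => // s Ps sI.
by move=> [y s] /= [Qy [sI Ps]]; exact: (PQ (s, y)).
Qed.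

Lemma jointly_continuous_slice u (t : R) : jointly_continuous u -> t \in `[0, T] ->
  continuous (u t).
Proof.
move=> ju tI x A /(ju t x tI) [[P Q] /= [Px Qt] PQ].
apply: filterS Px => y Py; apply: (PQ (y, t)); split => //=.
exact: (nbhs_singleton Qt).
Qed.

Lemma jointly_continuous_mulmx u (t : R) (y : 'rV[R]_d) :
  jointly_continuous u -> t \in `[0, T] ->
  u p.2 (p.1 *m B) @[p --> filter_prod (nbhs y) (within `[0, T]%classic (nbhs t))]
    --> u t (y *m B).
Proof.
move=> ju tI A /(ju t (y *m B) tI) [[P Q] /= [Px Qt] PQ].
exists ([set z | P (z *m B)], Q) => /=; last by move=> [z s] /= [Pz Qs]; exact: (PQ (_, _)).
split => //.
have cB : {for y, continuous (fun z : 'rV[R]_d => z *m B)} by exact: continuous_mulmxr.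
exact: cB.
Qed.

(** The time derivative is an explicit argument, so that composing the rules below computes it. *)
Definition C1_in_time u du :=
  [/\ jointly_continuous u, jointly_continuous du
    & forall (t : R) x, t \in `[0, T] -> is_derive_in `[0, T] (u ^~ x) t (du t x)].

Lemma C1_in_time_cst (f : 'rV[R]_d -> R) : continuous f ->
  C1_in_time (fun _ => f) (fun _ _ => 0).
Proof.
move=> cf; split => [t x _|t x _|t x _].
- by apply: cvg_comp; [exact: cvg_fst|exact: cf].
- exact: cvg_cst.
- exact: is_derive_in_cst.
Qed.

Lemma C1_in_time_add u du v dv : C1_in_time u du -> C1_in_time v dv ->
  C1_in_time (fun t x => u t x + v t x) (fun t x => du t x + dv t x).
Proof.
move=> [ju jdu Du] [jv jdv Dv]; split => t x tI.
- by apply: cvgD; [exact: ju|exact: jv].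
- by apply: cvgD; [exact: jdu|exact: jdv].
- by apply: is_derive_in_add; [exact: Du|exact: Dv].
Qed.

Lemma C1_in_time_mul u du v dv : C1_in_time u du -> C1_in_time v dv ->
  C1_in_time (fun t x => u t x * v t x) (fun t x => du t x * v t x + u t x * dv t x).
Proof.
move=> [ju jdu Du] [jv jdv Dv]; split => t x tI.
- by apply: cvgM; [exact: ju|exact: jv].
- apply: cvgD; first by apply: cvgM; [exact: jdu|exact: jv].
  by apply: cvgM; [exact: ju|exact: jdv].
- by apply: is_derive_in_mul; [exact: Du|exact: Dv].
Qed.

Lemma C1_in_time_ln u du : (forall (t : R) x, t \in `[0, T] -> 0 < u t x) ->
  C1_in_time u du ->
  C1_in_time (fun t x => ln (u t x)) (fun t x => (u t x)^-1 * du t x).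
Proof.
move=> u0 [ju jdu Du]; split => t x tI.
- apply: (@cvg_comp _ _ _ (fun p => u p.2 p.1) (@ln R) _ (nbhs (u t x))).
    exact: ju.
  by apply: continuous_ln; exact: u0.
- apply: cvgM; last exact: jdu.
  by apply: cvgV; [rewrite gt_eqF// u0|exact: ju].
- apply: (@is_derive_in_comp R _ (u ^~ x) (@ln R)); first exact: Du.
  by apply: is_derive_inT; apply: is_derive1_ln; exact: u0.
Qed.

Lemma is_derive_in_torus_int u du (t : R) : C1_in_time u du -> t \in `[0, T] ->
  is_derive_in `[0, T] (fun s => torus_int B (u s)) t (torus_int B (du t)).
Proof.
move=> [ju jdu Du] tI; rewrite /torus_int.
(* The value is put in the shape given by the product rule, with |det B| as a constant factor. *)
rewrite -[X in is_derive_in _ _ _ X]add0r.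
rewrite -[X in X + _](mul0r (cube_int (fun y => u t (y *m B)))).
apply: (@is_derive_in_mul R _ (fun=> `|\det B|) (fun s => cube_int (fun y => u s (y *m B)))).
  exact: is_derive_in_cst.
apply: (@is_derive_in_cube_int R d 0 T t (fun s y => u s (y *m B))
  (fun s y => du s (y *m B))) => //.
- by move=> s sI; apply: continuous_comp_mulmx; exact: jointly_continuous_slice.
- by move=> s sI; apply: continuous_comp_mulmx; exact: jointly_continuous_slice.
- by move=> s y sI; exact: Du.
- by move=> y _; exact: jointly_continuous_mulmx.
Qed.

Lemma periodic_pd i (f : 'rV[R]_d -> R) : periodic B f -> periodic B (pd i f).
Proof.
move=> pf x v Lv; rewrite /pd /derive.
suff -> : (fun s : R => s^-1 *: ((f \o shift (x + v)) (s *: basis_vec i) - f (x + v))) =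
    (fun s => s^-1 *: ((f \o shift x) (s *: basis_vec i) - f x)) by [].
by apply/funext => s /=; rewrite addrA !(pf _ _ Lv).
Qed.

Lemma Cn_on_periodic n u (t : R) : Cn_on T n u ->
  (forall s : R, s \in `[0, T] -> periodic B (u s)) -> t \in `[0, T] ->
  Cn_periodic B n (u t).
Proof.
elim: n u => [|n IH] u [/within_jointly_continuous ju Hu] pu tI.
  by split; [exact: jointly_continuous_slice|exact: pu|].
have [_ Du _ Cu] := Hu.
split; [exact: jointly_continuous_slice|exact: pu|].
move=> i; split; first by move=> x; exact: Du.
by apply: (IH (dx i u) (Cu i)) => // s sI; apply: periodic_pd; exact: pu.
Qed.

Lemma smooth_on_dt u : smooth_on T u -> smooth_on T (dt T u).
Proof. by move=> su n; have [_ []] := su n.+1. Qed.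

Lemma smooth_on_C1 u : smooth_on T u -> C1_in_time u (dt T u).
Proof.
move=> su; have [/within_jointly_continuous ju [Du _ _ _]] := su 1.
have [/within_jointly_continuous jdu _] := smooth_on_dt su 0.
by split => // t x tI; apply: derivable_inP; exact: Du.
Qed.

End time_dependent.

(** * Inequalities at a fixed time *)

(* Unfolding directional derivatives makes unification and [ring] diverge. *)
Local Opaque pd.

Ltac prove_smooth :=
  repeat first [ assumption | apply: smooth_pd | apply: smooth_cst
    | apply: smooth_add | apply: smooth_mul | apply: smooth_sum => ? ].

Section spatial_identities.
Context {R : realType} {d : nat} (B : 'M[R]_d) (uB : B \in unitmx).
Implicit Types f g : 'rV[R]_d -> R.

(** Smoothness and derivative travel together, so a term built from the rules below is a field
    component with its derivative already computed. *)
Definition has_pd (i : 'I_d) f f' := smooth_periodic B f /\ pd i f = f'.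

Lemma has_pd_smooth i f : smooth_periodic B f -> has_pd i f (pd i f).
Proof. by []. Qed.

Lemma has_pd_cst i (c : R) : has_pd i (fun=> c) (fun=> 0).
Proof.
by split; [exact: smooth_cst|apply/funext => x; exact: pd_cst].
Qed.

Lemma has_pd_add i f f' g g' : has_pd i f f' -> has_pd i g g' ->
  has_pd i (fun x => f x + g x) (fun x => f' x + g' x).
Proof.
move=> [sf <-] [sg <-]; split; first exact: smooth_add.
by apply/funext => x; apply: pd_add; exact: smooth_derivable.
Qed.

Lemma has_pd_mul i f f' g g' : has_pd i f f' -> has_pd i g g' ->
  has_pd i (fun x => f x * g x) (fun x => f' x * g x + f x * g' x).
Proof.
move=> [sf <-] [sg <-]; split; first exact: smooth_mul.
by apply/funext => x; apply: pd_mul; exact: smooth_derivable.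
Qed.

Lemma has_pd_inv i f f' : (forall x, f x != 0) -> has_pd i f f' ->
  has_pd i (fun x => (f x)^-1) (fun x => -1 * (f' x * ((f x)^-1 * (f x)^-1))).
Proof.
move=> f0 [sf <-]; split; first exact: smooth_inv.
by apply/funext => x; apply: pd_inv => //; exact: smooth_derivable.
Qed.

Lemma has_pd_ln i f f' : (forall x, 0 < f x) -> has_pd i f f' ->
  has_pd i (fun x => ln (f x)) (fun x => f' x * (f x)^-1).
Proof.
move=> f0 [sf <-]; split; first exact: smooth_ln.
by apply/funext => x; apply: pd_ln => //; exact: smooth_derivable.
Qed.

(** The index type is left general to serve both single sums over i and double sums over pairs (i,
    j). *)
Lemma torus_int_div_eq0 (K : finType) (i : K -> 'I_d) (F F' : K -> 'rV[R]_d -> R) :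
  (forall k, has_pd (i k) (F k) (F' k)) ->
  torus_int B (fun x => \sum_k F' k x) = 0.
Proof.
move=> FF'; rewrite torus_int_sum.
  by apply: big1 => k _; have [sF <-] := FF' k; exact: torus_int_pd.
by move=> k; have [sF <-] := FF' k; apply: smooth_continuous; exact: smooth_pd.
Qed.

Lemma continuous_div (K : finType) (i : K -> 'I_d) (F F' : K -> 'rV[R]_d -> R) :
  (forall k, has_pd (i k) (F k) (F' k)) -> continuous (fun x => \sum_k F' k x).
Proof.
move=> FF'; apply: continuous_sumr => k; have [sF <-] := FF' k.
by apply: smooth_continuous; exact: smooth_pd.
Qed.

Lemma torus_int_eq_mod_div (K : finType) (i : K -> 'I_d)
    (F F' : K -> 'rV[R]_d -> R) f g :
  (forall k, has_pd (i k) (F k) (F' k)) -> continuous f ->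
  (forall x, g x = f x + \sum_k F' k x) -> torus_int B f = torus_int B g.
Proof.
move=> FF' cf /funext ->; rewrite torus_int_add//; last exact: continuous_div FF'.
by rewrite (torus_int_div_eq0 FF') addr0.
Qed.

Lemma torus_int_ge0_mod_div (K : finType) (i : K -> 'I_d)
    (F F' : K -> 'rV[R]_d -> R) f :
  (forall k, has_pd (i k) (F k) (F' k)) -> continuous f ->
  (forall x, 0 <= f x + \sum_k F' k x) -> 0 <= torus_int B f.
Proof.
move=> FF' cf fF; rewrite (torus_int_eq_mod_div FF' cf (fun=> erefl)).
by apply: torus_int_ge0 => //; apply: continuous_add => //; exact: continuous_div FF'.
Qed.

Lemma torus_int_ge0_mod_div2 (F F' : 'I_d -> 'I_d -> 'rV[R]_d -> R) f :
  (forall i j, has_pd i (F i j) (F' i j)) -> continuous f ->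
  (forall x, 0 <= f x + \sum_i \sum_j F' i j x) -> 0 <= torus_int B f.
Proof.
move=> FF' cf fF.
apply: (@torus_int_ge0_mod_div ('I_d * 'I_d)%type (fun k => k.1)
  (fun k => F k.1 k.2) (fun k => F' k.1 k.2)) => // x.
by rewrite -(pair_bigA _ (fun i j => F' i j x)).
Qed.

(** Exchanging the two sums shows that the total equals its own opposite. *)
Lemma antisymmetric_sum (K : 'I_d -> 'I_d -> R) :
  (forall i j, K i j = - K j i) -> \sum_i \sum_j K i j = 0.
Proof.
move=> aK; apply/eqP; rewrite -[_ == 0](mulrn_eq0 _ 2) mulr2n -{1}exchange_big/=.
by rewrite -big_split big1// => i _; rewrite -big_split big1// => j _ /=; rewrite aK addNr.
Qed.

Context (u : 'rV[R]_d -> R) (su : smooth_periodic B u).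

Lemma smooth_laplacian f : smooth_periodic B f -> smooth_periodic B (laplacian f).
Proof. by move=> sf; prove_smooth. Qed.

Lemma smooth_flow : smooth_periodic B (flow u).
Proof. by prove_smooth. Qed.

Let U i := has_pd_smooth i su.
Let U1 i j := has_pd_smooth i (smooth_pd j su).
Let U2 i j k := has_pd_smooth i (smooth_pd j (smooth_pd k su)).

(** Since [flow u] is half the Laplacian of u^2, this is Green's identity. The field has components
    1/2 u^2 phi_i - phi u u_i, so both integrations by parts happen at once. *)
Lemma flow_weak (phi : 'rV[R]_d -> R) : smooth_periodic B phi ->
  torus_int B (fun x => phi x * flow u x) =
  torus_int B (fun x => 2^-1 * (u x * u x) * laplacian phi x).
Proof.
move=> sphi; have P i := has_pd_smooth i sphi.
have P1 i j := has_pd_smooth i (smooth_pd j sphi).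
have H i := has_pd_add
  (has_pd_mul (has_pd_mul (has_pd_cst i 2^-1) (has_pd_mul (U i) (U i))) (P1 i i))
  (has_pd_mul (has_pd_cst i (-1)) (has_pd_mul (P i) (has_pd_mul (U i) (U1 i i)))).
apply: (torus_int_eq_mod_div H).
  by apply: smooth_continuous; apply: smooth_mul => //; exact: smooth_flow.
move=> x; rewrite /flow /laplacian !mulr_sumr -big_split; apply: eq_bigr => i _ /=.
move: (phi x) (u x) (pd i phi x) (pd i u x) (pd i (pd i phi) x) (pd i (pd i u) x).
by move=> p v p1 v1 p2 v2; field.
Qed.

(** Adding the divergence of 2 u (u grad u) leaves 2 u |grad u|^2. *)
Lemma dissipation_sqr : (forall x, 0 < u x) ->
  0 <= torus_int B (fun x => - (2 * (u x * flow u x))).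
Proof.
move=> u0.
have H i := has_pd_mul (has_pd_cst i 2) (has_pd_mul (U i) (has_pd_mul (U i) (U1 i i))).
apply: (torus_int_ge0_mod_div H).
  apply: smooth_continuous; rewrite (_ : (fun x => _) = fun x => -2 * (u x * flow u x)).
    by have := smooth_flow => ?; prove_smooth.
  by apply/funext => x; rewrite mulNr.
move=> x; rewrite /flow !mulr_sumr -sumrN -big_split; apply: sumr_ge0 => i _ /=.
set a := pd i u x; set c := pd i _ x.
rewrite [leRHS](_ : _ = 2 * u x * a ^+ 2); last by ring.
by rewrite mulr_ge0 ?sqr_ge0// mulr_ge0// ltW.
Qed.

(** Adding the divergence of (ln u + 1) u grad u leaves |grad u|^2: the u in the flux cancels the
    1/u from the logarithm. *)
Lemma dissipation_entropy : (forall x, 0 < u x) ->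
  0 <= torus_int B (fun x => - (flow u x * ln (u x) + flow u x)).
Proof.
move=> u0.
have H i := has_pd_mul (has_pd_add (has_pd_ln u0 (U i)) (has_pd_cst i 1))
  (has_pd_mul (U i) (U1 i i)).
apply: (torus_int_ge0_mod_div H).
  apply: smooth_continuous.
  rewrite (_ : (fun x => _) = fun x => -1 * (flow u x * ln (u x) + flow u x)).
    by have := smooth_flow => ?; have := smooth_ln u0 su => ?; prove_smooth.
  by apply/funext => x; rewrite mulN1r.
move=> x; rewrite /flow mulr_suml -big_split -sumrN -big_split.
apply: sumr_ge0 => i _ /=.
set a := pd i u x; set c := pd i _ x.
have ux : u x != 0 by rewrite gt_eqF.
by rewrite [leRHS](_ : _ = a ^+ 2) ?sqr_ge0//; field.
Qed.

(** The derivative is recorded with j outermost, so that it mirrors the derivative of u_jj along i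
    when i and j are swapped. *)
Lemma has_pd_third i j : has_pd i (pd i (pd j u)) (pd j (pd i (pd i u))).
Proof.
split; first by prove_smooth.
have -> : pd i (pd j u) = pd j (pd i u).
  by apply/funext => y; exact: pd_commute su.
apply/funext => x; exact: pd_commute (smooth_pd i su).
Qed.

(* The divergence added is that of the field with components
   -2 sum_j (u^2 (u_jj u_i - u_ij u_j) + u u_j^2 u_i). What is left besides the
   nonnegative terms is antisymmetric in (i, j), once third derivatives are
   commuted, and so sums to 0. *)
Lemma convexity_sqr :
  0 <= torus_int B (fun x => 2 * (flow u x * flow u x) +
    2 * (u x * flow u x * laplacian u x)).
Proof.
have H i j := has_pd_mul (has_pd_cst i (-2)) (has_pd_add
    (has_pd_mul (has_pd_mul (U i) (U i))
      (has_pd_add (has_pd_mul (U2 i j j) (U1 i i))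
        (has_pd_mul (has_pd_cst i (-1)) (has_pd_mul (has_pd_third i j) (U1 i j)))))
    (has_pd_mul (U i) (has_pd_mul (has_pd_mul (U1 i j) (U1 i j)) (U1 i i)))).
apply: (torus_int_ge0_mod_div2 H).
  apply: smooth_continuous; have := smooth_flow => ?.
  by have := smooth_laplacian su => ?; prove_smooth.
move=> x.
pose N i j := 2 * ((u x * pd i (pd i u) x) * (u x * pd j (pd j u) x)) +
  2 * (u x * pd i (pd j u) x) ^+ 2.
pose K i j := -2 * (u x * u x) * (pd i (pd j (pd j u)) x * pd i u x
  - pd j (pd i (pd i u)) x * pd j u x).
rewrite [leRHS](_ : _ = \sum_i \sum_j N i j + \sum_i \sum_j K i j).
  rewrite [X in _ + X]antisymmetric_sum ?addr0; last first.
    move=> i j; rewrite /K.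
    move: (u x) (pd i u x) (pd j u x) (pd i (pd j (pd j u)) x)
      (pd j (pd i (pd i u)) x).
    by move=> v vi vj vijj vjii; ring.
  (* The products of diagonal second derivatives sum to the square of u Lap u. *)
  rewrite (_ : \sum_i _ = 2 * (\sum_i u x * pd i (pd i u) x) ^+ 2 +
    \sum_i \sum_j 2 * (u x * pd i (pd j u) x) ^+ 2); last first.
    rewrite expr2 big_distrlr/= mulr_sumr -big_split; apply: eq_bigr => i _ /=.
    by rewrite mulr_sumr -big_split.
  apply: addr_ge0; first by rewrite mulr_ge0 ?sqr_ge0.
  apply: sumr_ge0 => i _; apply: sumr_ge0 => j _.
  by rewrite mulr_ge0 ?sqr_ge0.
(* This factorization assigns the index i to the first factor and j to the second, so that the
   double sums agree term by term. *)
rewrite (_ : 2 * _ + _ = flow u x * (2 * flow u x + 2 * u x * laplacian u x)); last by ring.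
rewrite {2}/flow /laplacian !mulr_sumr -big_split /flow big_distrlr/=.
rewrite -!big_split; apply: eq_bigr => i _ /=; rewrite -!big_split.
apply: eq_bigr => j _ /=.
rewrite /N /K.
move: (u x) (pd i u x) (pd j u x) (pd i (pd i u) x) (pd j (pd j u) x)
  (pd i (pd j u) x) (pd i (pd j (pd j u)) x) (pd j (pd i (pd i u)) x).
by move=> v vi vj vii vjj vij vijj vjii; ring.
Qed.

(* Same argument with the field
   -2/3 sum_j (2 u (u_jj u_i - u_ij u_j) + u_j^2 u_i). *)
Lemma convexity_entropy : (forall x, 0 < u x) ->
  0 <= torus_int B (fun x => 2 * (flow u x * laplacian u x)).
Proof.
move=> u0.
have H i j := has_pd_mul (has_pd_cst i (- (2 / 3))) (has_pd_add
    (has_pd_mul (has_pd_mul (has_pd_cst i 2) (U i))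
      (has_pd_add (has_pd_mul (U2 i j j) (U1 i i))
        (has_pd_mul (has_pd_cst i (-1)) (has_pd_mul (has_pd_third i j) (U1 i j)))))
    (has_pd_mul (has_pd_mul (U1 i j) (U1 i j)) (U1 i i))).
apply: (torus_int_ge0_mod_div2 H).
  apply: smooth_continuous; have := smooth_flow => ?.
  by have := smooth_laplacian su => ?; prove_smooth.
move=> x.
pose N i j := 2 / 3 * (u x * (pd i (pd i u) x * pd j (pd j u) x)) +
  4 / 3 * (u x * (pd i (pd j u) x) ^+ 2).
(* The first bracket appears because the integrand and the first field contribute u_i^2 u_jj, while
   the second field contributes u_j^2 u_ii. *)
pose K i j := 2 / 3 * (pd i u x ^+ 2 * pd j (pd j u) x - pd j u x ^+ 2 * pd i (pd i u) x)
  - 4 / 3 * u x * (pd i (pd j (pd j u)) x * pd i u x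
  - pd j (pd i (pd i u)) x * pd j u x).
rewrite [leRHS](_ : _ = \sum_i \sum_j N i j + \sum_i \sum_j K i j).
  rewrite [X in _ + X]antisymmetric_sum ?addr0; last first.
    move=> i j; rewrite /K.
    move: (u x) (pd i u x) (pd j u x) (pd i (pd i u) x) (pd j (pd j u) x) (pd i (pd j (pd j u)) x)
      (pd j (pd i (pd i u)) x).
    by move=> v vi vj vii vjj vijj vjii; field.
  rewrite (_ : \sum_i _ = 2 / 3 * u x * (\sum_i pd i (pd i u) x) ^+ 2 +
    \sum_i \sum_j 4 / 3 * (u x * (pd i (pd j u) x) ^+ 2)); last first.
    rewrite expr2 big_distrlr/= mulr_sumr -big_split; apply: eq_bigr => i _ /=.
    rewrite mulr_sumr -big_split; apply: eq_bigr => j _ /=.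
    rewrite /N; move: (u x) (pd i (pd i u) x) (pd j (pd j u) x) (pd i (pd j u) x).
    by move=> v vii vjj vij; field.
  have ux := ltW (u0 x).
  have c1 : 0 <= 2 / 3 :> R by rewrite divr_ge0.
  have c2 : 0 <= 4 / 3 :> R by rewrite divr_ge0.
  apply: addr_ge0.
    by apply: mulr_ge0; [exact: mulr_ge0|exact: sqr_ge0].
  apply: sumr_ge0 => i _; apply: sumr_ge0 => j _.
  by apply: mulr_ge0 => //; apply: mulr_ge0 => //; exact: sqr_ge0.
rewrite mulrCA /flow /laplacian mulr_sumr big_distrlr/=.
rewrite -!big_split; apply: eq_bigr => i _ /=; rewrite -!big_split.
apply: eq_bigr => j _ /=.
rewrite /N /K.
move: (u x) (pd i u x) (pd j u x) (pd i (pd i u) x) (pd j (pd j u) x)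
  (pd i (pd j u) x) (pd i (pd j (pd j u)) x) (pd j (pd i (pd i u)) x).
by move=> v vi vj vii vjj vij vijj vjii; field.
Qed.

End spatial_identities.
(** * Evolution of the two functionals *)

(** The second derivative is that of the function [derive_in E], so the formula for the first must
    hold on all of [0, T] before it can be differentiated again. *)
Lemma sign_of_derivatives (R : realType) (T : R) (E E' E'' : R -> R) : 0 < T ->
  (forall t, t \in `[0, T] -> is_derive_in `[0, T] E t (E' t)) ->
  (forall t, t \in `[0, T] -> is_derive_in `[0, T] E' t (E'' t)) ->
  (forall t, t \in `[0, T] -> E' t <= 0) ->
  (forall t, t \in `[0, T] -> 0 <= E'' t) ->
  forall t, t \in `[0, T] ->
    (derivable_in `[0, T] E t /\ derive_in `[0, T] E t <= 0) /\
    (derivable_in `[0, T] (derive_in `[0, T] E) t /\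
     0 <= derive_in `[0, T] (derive_in `[0, T] E) t).
Proof.
move=> T0 EE' E'E'' E'0 E''0 t tI.
have DE s (sI : s \in `[0, T]) := is_derive_in_val T0 sI (EE' s sI).
have DDE : is_derive_in `[0, T] (derive_in `[0, T] E) t (E'' t).
  apply: is_derive_in_ext (E'E'' t tI) => // s sI.
  by have [_ ->] := DE s sI.
have [dE ->] := DE t tI; have [ddE ->] := is_derive_in_val T0 tI DDE.
by do 2 split => //; [exact: E'0|exact: E''0].
Qed.

Section boussinesq.
Context {R : realType} {d : nat} (T : R) (B : 'M[R]_d).
Context (h ht htt : R -> 'rV[R]_d -> R).
Context (T_gt0 : 0 < T) (B_unit : B \in unitmx).
Context (h_smooth : forall t : R, t \in `[0, T] -> smooth_periodic B (h t)).
Context (h_gt0 : forall (t : R) x, t \in `[0, T] -> 0 < h t x).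
Context (h_C1 : C1_in_time T h ht) (ht_C1 : C1_in_time T ht htt).
Context (h_flow : forall (t : R) x, t \in `[0, T] -> ht t x = flow (h t) x).

Let ht_cont (t : R) : t \in `[0, T] -> continuous (ht t).
Proof. by case: ht_C1 => j _ _; exact: jointly_continuous_slice. Qed.

Let htt_cont (t : R) : t \in `[0, T] -> continuous (htt t).
Proof. by case: ht_C1 => _ j _; exact: jointly_continuous_slice. Qed.

(* Differentiating the weak form of the equation against a test function that
   does not depend on time avoids commuting time and space derivatives. *)
Lemma weak_second_derivative (phi : 'rV[R]_d -> R) (t : R) :
  smooth_periodic B phi -> t \in `[0, T] ->
  torus_int B (fun x => phi x * htt t x) =
  torus_int B (fun x => h t x * ht t x * laplacian phi x).
Proof.
move=> sphi tI.
have cphi := smooth_continuous sphi.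
have clap := smooth_continuous (smooth_laplacian sphi).
have H1 := is_derive_in_torus_int (B := B) (C1_in_time_mul (C1_in_time_cst T cphi) ht_C1) tI.
have H2 := is_derive_in_torus_int (B := B) (C1_in_time_mul (C1_in_time_mul
  (C1_in_time_cst T (@continuous_cst R 'rV[R]_d 2^-1)) (C1_in_time_mul h_C1 h_C1))
  (C1_in_time_cst T clap)) tI.
transitivity (torus_int B (fun x => 0 * ht t x + phi x * htt t x)).
  by congr torus_int; apply/funext => x; rewrite mul0r add0r.
transitivity (torus_int B (fun x => (0 * (h t x * h t x) +
    2^-1 * (ht t x * h t x + h t x * ht t x)) * laplacian phi x +
    2^-1 * (h t x * h t x) * 0)); last first.
  congr torus_int; apply/funext => x.
  by move: (h t x) (ht t x) (laplacian phi x) => a b c; field.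
(* Both sides are derivatives at t of one function of time, by the weak form at every s in
   [0, T]. *)
apply: (is_derive_in_unique T_gt0 tI _ H2).
apply: is_derive_in_ext H1 => // s sI.
rewrite -(flow_weak B_unit (h_smooth sI) sphi).
by congr torus_int; apply/funext => x; rewrite h_flow.
Qed.

Lemma is_derive_sqr (t : R) : t \in `[0, T] ->
  is_derive_in `[0, T] (fun s => torus_int B (fun x => h s x ^+ 2)) t
    (torus_int B (fun x => 2 * (h t x * ht t x))).
Proof.
move=> tI; have := is_derive_in_torus_int (B := B) (C1_in_time_mul h_C1 h_C1) tI.
rewrite (_ : (fun x => _) = fun x => 2 * (h t x * ht t x)) //.
by apply/funext => x; ring.
Qed.

Lemma is_derive2_sqr (t : R) : t \in `[0, T] ->
  is_derive_in `[0, T] (fun s => torus_int B (fun x => 2 * (h s x * ht s x))) t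
    (torus_int B (fun x => 2 * (flow (h t) x * flow (h t) x) +
       2 * (h t x * flow (h t) x * laplacian (h t) x))).
Proof.
move=> tI; have := is_derive_in_torus_int (B := B) (C1_in_time_mul
  (C1_in_time_cst T (@continuous_cst R 'rV[R]_d 2)) (C1_in_time_mul h_C1 ht_C1)) tI.
have ch := smooth_continuous (h_smooth tI).
have cht := ht_cont tI; have chtt := htt_cont tI.
have clap := smooth_continuous (smooth_laplacian (h_smooth tI)).
congr is_derive_in.
transitivity (torus_int B (fun x => 2 * (ht t x * ht t x) + 2 * (h t x * htt t x))).
  by congr torus_int; apply/funext => x; rewrite mul0r add0r mulrDr.
have c2 (f : 'rV[R]_d -> R) : continuous f -> continuous (fun x => 2 * f x).
  by apply: continuous_mul; exact: continuous_cst.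
have c3 : continuous (fun x => h t x * ht t x * laplacian (h t) x).
  by do 2 apply: continuous_mul => //.
rewrite torus_int_add; [|by apply: c2; exact: continuous_mul..].
rewrite [X in _ + X]torus_int_scale; last exact: continuous_mul.
(* The test function is h frozen at time t; freezing is legitimate because the time differentiation
   is already done. *)
rewrite (weak_second_derivative (h_smooth tI) tI) -torus_int_scale//.
rewrite -torus_int_add; [|by apply: c2; exact: continuous_mul|exact: c2].
by congr torus_int; apply/funext => x; rewrite h_flow.
Qed.

Lemma is_derive_entropy (t : R) : t \in `[0, T] ->
  is_derive_in `[0, T] (fun s => torus_int B (fun x => h s x * ln (h s x))) t
    (torus_int B (fun x => ht t x * ln (h t x) + ht t x)).
Proof.
move=> tI.
have := is_derive_in_torus_int (B := B) (C1_in_time_mul h_C1 (C1_in_time_ln h_gt0 h_C1)) tI.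
congr is_derive_in; congr torus_int; apply/funext => x.
by rewrite mulrA mulfV ?mul1r// gt_eqF// h_gt0.
Qed.

(** The term |grad u|^2 / u is what later combines with w^2 / u, the contribution of differentiating
    the logarithm in time. *)
Lemma laplacian_ln (u : 'rV[R]_d -> R) x : smooth_periodic B u -> (forall y, 0 < u y) ->
  u x * laplacian (fun y => ln (u y) + 1) x = laplacian u x - (u x)^-1 *
    \sum_i pd i u x * pd i u x.
Proof.
move=> su u0; have un0 y : u y != 0 by rewrite gt_eqF.
rewrite /laplacian !mulr_sumr -sumrB; apply: eq_bigr => i _.
have [_ ->] := has_pd_add (has_pd_ln u0 (has_pd_smooth i su)) (has_pd_cst B i 1).
have [_ ->] := has_pd_add (has_pd_mul (has_pd_smooth i (smooth_pd i su))
  (has_pd_inv un0 (has_pd_smooth i su))) (has_pd_cst B i 0).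
have := un0 x; move: (u x) (pd i u x) (pd i (pd i u) x) => a b c a0.
by field.
Qed.

Lemma is_derive2_entropy (t : R) : t \in `[0, T] ->
  is_derive_in `[0, T]
    (fun s => torus_int B (fun x => ht s x * ln (h s x) + ht s x)) t
    (torus_int B (fun x => 2 * (flow (h t) x * laplacian (h t) x))).
Proof.
move=> tI; have := is_derive_in_torus_int (B := B) (C1_in_time_add
  (C1_in_time_mul ht_C1 (C1_in_time_ln h_gt0 h_C1)) ht_C1) tI.
have su := h_smooth tI; have u0 x := h_gt0 x tI.
have sphi := smooth_add (smooth_ln u0 su) (smooth_cst B 1).
have ch := smooth_continuous su; have cphi := smooth_continuous sphi.
have cht := ht_cont tI; have chtt := htt_cont tI.
have clap := smooth_continuous (smooth_laplacian sphi).
have cinv : continuous (fun x => ht t x * ((h t x)^-1 * ht t x)).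
  apply: continuous_mul => //; apply: continuous_mul => //.
  by apply: continuous_inv => // x; rewrite gt_eqF.
congr is_derive_in.
transitivity (torus_int B (fun x => (ln (h t x) + 1) * htt t x +
    ht t x * ((h t x)^-1 * ht t x))).
  congr torus_int; apply/funext => x.
  by move: (htt t x) (ln _) (ht t x * _) => a b c; ring.
rewrite torus_int_add//; last exact: continuous_mul.
rewrite (weak_second_derivative sphi tI) -torus_int_add//; last first.
  by do 2 apply: continuous_mul => //.
congr torus_int; apply/funext => x.
rewrite mulrAC laplacian_ln// h_flow//.
(* With |grad u|^2 = w - u Lap u, the two quotients by u reduce to a second copy of w Lap u. *)
have -> : \sum_i pd i (h t) x * pd i (h t) x = flow (h t) x - h t x * laplacian (h t) x.
  rewrite /flow /laplacian mulr_sumr -sumrB; apply: eq_bigr => i _.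
  by rewrite addrK.
have : h t x != 0 by rewrite gt_eqF.
move: (h t x) (flow _ x) (laplacian _ x) => a b c a0.
by field.
Qed.

End boussinesq.

Theorem theorem2p6 (R : realType) (d : nat) (T : R) (B : 'M[R]_d)
    (h : R -> 'rV[R]_d -> R)
    (d_ge1 : (1 <= d)%N) (T_gt0 : 0 < T) (B_unit : B \in unitmx)
    (h_periodic : forall t : R, t \in `[0, T] -> periodic B (h t))
    (h_smooth : smooth_on T h)
    (h_gt0 : forall (t : R) x, t \in `[0, T] -> 0 < h t x)
    (h_eq : forall (t : R) x, t \in `[0, T] ->
      dt T h t x - div (fun y => h t y *: grad (h t) y) x = 0) :
  let I := `[0, T]%classic in
  let E1 := fun t : R => torus_int B (fun x => h t x ^+ 2) in
  let E2 := fun t : R => torus_int B (fun x => h t x * ln (h t x)) in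
  forall t : R, t \in `[0, T] ->
    (derivable_in I E1 t /\ derive_in I E1 t <= 0) /\
    (derivable_in I (derive_in I E1) t /\ 0 <= derive_in I (derive_in I E1) t) /\
    (derivable_in I E2 t /\ derive_in I E2 t <= 0) /\
    (derivable_in I (derive_in I E2) t /\ 0 <= derive_in I (derive_in I E2) t).
Proof.
have C1h := smooth_on_C1 h_smooth.
have C1ht := smooth_on_C1 (smooth_on_dt h_smooth).
have sh (t : R) : t \in `[0, T] -> smooth_periodic B (h t).
  by move=> tI n; exact: (Cn_on_periodic (h_smooth n)).
have hf (t : R) x : t \in `[0, T] -> dt T h t x = flow (h t) x.
  move=> tI; apply/eqP; rewrite -subr_eq0 -(div_flux x (sh t tI)).
  by apply/eqP; exact: h_eq.
move=> I E1 E2 t tI.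
have [S1 S2] : (derivable_in I E1 t /\ derive_in I E1 t <= 0) /\
    (derivable_in I (derive_in I E1) t /\ 0 <= derive_in I (derive_in I E1) t).
  apply: (sign_of_derivatives T_gt0 (is_derive_sqr (B := B) C1h)
    (is_derive2_sqr T_gt0 B_unit sh C1h C1ht hf)) => // s sI.
  (* The dissipation lemma bounds the integral of the negated integrand, so the sign is moved inside
     as a factor -1. *)
  - rewrite -oppr_ge0 -mulN1r -torus_int_scale.
      rewrite (_ : (fun x => _) = fun x => - (2 * (h s x * flow (h s) x))).
        by apply: (dissipation_sqr B_unit (sh s sI)) => x; exact: h_gt0.
      by apply/funext => x; rewrite mulN1r hf.
    apply: continuous_mul; first exact: continuous_cst.
    apply: continuous_mul; first exact: smooth_continuous (sh s sI).
    by case: C1h => _ j _; exact: (jointly_continuous_slice j sI).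
  - exact: (convexity_sqr B_unit (sh s sI)).
have [S3 S4] : (derivable_in I E2 t /\ derive_in I E2 t <= 0) /\
    (derivable_in I (derive_in I E2) t /\ 0 <= derive_in I (derive_in I E2) t).
  apply: (sign_of_derivatives T_gt0 (is_derive_entropy (B := B) h_gt0 C1h)
    (is_derive2_entropy T_gt0 B_unit sh h_gt0 C1h C1ht hf)) => // s sI.
  - rewrite -oppr_ge0 -mulN1r -torus_int_scale.
      rewrite (_ : (fun x => _) = fun x => - (flow (h s) x * ln (h s x) + flow (h s) x)).
        by apply: (dissipation_entropy B_unit (sh s sI)) => x; exact: h_gt0.
      by apply/funext => x; rewrite mulN1r hf.
    have cht : continuous (dt T h s).
      by case: C1h => _ j _; exact: (jointly_continuous_slice j sI).
    apply: continuous_add => //; apply: continuous_mul => //.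
    apply: continuous_ln_comp; first exact: smooth_continuous (sh s sI).
    by move=> x; exact: h_gt0.
  - by apply: (convexity_entropy B_unit (sh s sI)) => x; exact: h_gt0.
by [].
Qed.
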